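(* Fix real numbers $\alpha>0$ and $\beta\in[0,1]$. For each $n\ge1$, let $\mathbf c_n$ be a Coxeter word over $\{1,\dots,n-1\}$ corresponding to a lattice path $\Lambda_{\swarrow}^{(n)}\in\boldsymbol\Lambda_n$. Suppose $\theta_{\Lambda_{\swarrow}^{(n)}}$ converges pointwise to the function $\varphi\in\mathfrak B$ given by $\varphi(z)=\beta z$. Let $v_n$ be a permutation chosen uniformly at random from $\mathfrak S_n$, and let $u_n=\tau_{\mathbf c_n}^{\lfloor\alpha n\rfloor}(v_n)$. The sequence $(\pi_{u_n})_{n\ge1}$ of permutons converges weakly to $\nu^{\alpha,\beta}$.
   Context: Permutons. A permuton is a probability measure on $[0,1]^2$ with uniform marginals. For $u\in\mathfrak S_n$ (the symmetric group), $\pi_u$ is the permuton with constant density $n$ on each of the squares $[\frac{i-1}{n},\frac in]\times[\frac{u(i)-1}{n},\frac{u(i)}{n}]$, $1\le i\le n$, and density $0$ elsewhere. Operators. For $i\in\{1,\dots,n-1\}$, $\tau_i:\mathfrak S_n\to\mathfrak S_n$ puts the entries of $u$ in positions $i,i+1$ into decreasing order, leaving the rest unchanged: with $s_i=(i\;\,i+1)$, $\tau_i(u)=us_i$ if $u(i)<u(i+1)$ and $\tau_i(u)=u$ otherwise. For a word $\mathbf u=(i_1,\dots,i_r)$ over $\{1,\dots,n-1\}$, $\tau_{\mathbf u}=\tau_{i_r}\circ\cdots\circ\tau_{i_1}$; $\tau_{\mathbf u}^k$ is its $k$-th iterate. Coxeter words and paths. A Coxeter word over $\{1,\dots,n-1\}$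 is a word using each letter exactly once. Let $\mathfrak L_a=\{(x,y)\in\mathbb R^2:x-y=a\}$, and let $\boldsymbol\Lambda_n$ be the set of lattice paths with unit east steps and unit south steps that start on $\mathfrak L_0$ and end on $\mathfrak L_n$. The path in $\boldsymbol\Lambda_n$ corresponding to a Coxeter word $\mathbf c_n$ is the path that starts at $(0,0)$, begins with a south step, ends with an east step, and for $1\le j\le n-2$ has as its step from $\mathfrak L_j$ to $\mathfrak L_{j+1}$ an east step if $j$ appears before $j+1$ in $\mathbf c_n$ and a south step if $j+1$ appears before $j$. $\mathfrak B$ is the set of continuous, piecewise smooth functions $\theta:[0,1]\to\mathbb R$ whose derivative lies in $[0,1]$ at every point where it exists. For $\Lambda\in\boldsymbol\Lambda_n$, $\theta_\Lambda\in\mathfrak B$ is the function such that the scaled path $\frac1n\Lambda$ is the curve $\{(\theta_\Lambda(z),\theta_\Lambda(z)-z):0\le z\le1\}$. The permuton $\nu^{\alpha,\beta}$, for $\alpha>0$ and $\beta\in[0,1]$ (with $\alpha/0$ interpreted as $\infty$). Define curves $$\mathscr C_{\searrow}^{\alpha,\beta}=\Big\{\Big(x,1-\tfrac{\alpha}{(1-\beta)(1-x)+\alpha}\Big):\max\{\tfrac{\alpha}{1-\beta},1-\tfrac\alpha\beta\}\le x\le1\Big\},$$ $$\mathscr C_{\nwarrow}^{\alpha,\beta}=\Big\{\Big(x,\tfrac{\alpha}{\beta x+\alpha}\Big):0\le x\le\min\{\tfrac{\alpha}{1-\beta},1-\tfrac\alpha\beta\}\Big\},$$ regions $$\mathscr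 U_{\searrow}^{\alpha,\beta}=\Big\{(x,y)\in[\tfrac{\alpha}{1-\beta},1]\times[0,\min\{1-\beta,1-\tfrac{\alpha}{1-\beta}\}]:y\le1-\tfrac{\alpha}{(1-\beta)(1-x)+\alpha}\Big\},$$ $$\mathscr U_{\nwarrow}^{\alpha,\beta}=\Big\{(x,y)\in[0,1-\tfrac\alpha\beta]\times[\max\{1-\beta,\tfrac\alpha\beta\},1]:y\ge\tfrac{\alpha}{\beta x+\alpha}\Big\},$$ and the (possibly empty) line segment $$\mathscr L^{\alpha,\beta}=\{(x,1-x)\in[0,1]^2:1-\tfrac\alpha\beta\le x\le\tfrac{\alpha}{1-\beta}\}.$$ The permuton $\nu^{\alpha,\beta}$ is defined so that for every measurable set $A\subseteq[0,1]^2$, $$\nu^{\alpha,\beta}(A)=\iint_{A\cap(\mathscr U_{\searrow}^{\alpha,\beta}\cup\mathscr U_{\nwarrow}^{\alpha,\beta})}dx\,dy+\int_{A\cap\mathscr C_{\searrow}^{\alpha,\beta}}\Big(x-\frac{\alpha}{1-\beta}\Big)dx+\int_{A\cap\mathscr C_{\nwarrow}^{\alpha,\beta}}\Big(1-\frac{\alpha}{\beta}-x\Big)dx+\int_{A\cap\mathscr L^{\alpha,\beta}}dx.$$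
   Formalization: In the definition of ν^{α,β} the densities on the curves C_↘ and C_↖ are corrected to α/((1-β)(1-x)+α) and α/(βx+α); those printed, x-α/(1-β) and 1-α/β-x, do not give a probability measure (β=0, α=1/2 has total mass about 0.78). *)

(* Defs.v *)
From HB Require Import structures.
From mathcomp Require Import all_boot all_order all_algebra all_fingroup.
From mathcomp Require Import all_classical all_reals all_analysis.
From mathcomp Require Import measurable_realfun ring lra.

Set Implicit Arguments.
Unset Strict Implicit.
Unset Printing Implicit Defensive.

Import Order.TTheory GRing.Theory Num.Theory.
Import numFieldNormedType.Exports.

Local Open Scope classical_set_scope.
Local Open Scope ring_scope.

(** * Coxeter words and the operators [tau] *)

Section operators.
Variable n : nat.

(* The letter [i : 'I_n.-1] stands for i + 1 in {1, ..., n - 1}; permutations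
   of {1, ..., n} are permutations of 'I_n.  The letter acts on the positions
   [posl i] and [posr i], the 0-based counterparts of (i + 1) and (i + 2). *)
Definition posl (i : 'I_n.-1) : 'I_n := widen_ord (leq_pred n) i.

Lemma posr_subproof (i : 'I_n.-1) : (i.+1 < n)%N.
Proof. by case: i => i /=; case: n. Qed.

Definition posr (i : 'I_n.-1) : 'I_n := Ordinal (posr_subproof i).

(* In [perm], (s * t) x = t (s x): the product below is u o s_i. *)
Definition tau (i : 'I_n.-1) (u : 'S_n) : 'S_n :=
  if (u (posl i) < u (posr i))%N then (tperm (posl i) (posr i) * u)%g else u.

Definition tau_word (w : seq 'I_n.-1) (u : 'S_n) : 'S_n :=
  foldl (fun u i => tau i u) u w.

Definition coxeter_word (c : seq 'I_n.-1) : Prop :=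
  forall i : 'I_n.-1, count_mem i c = 1%N.

(* [appears_before c j k]: the letters j and k of {1, ..., n - 1}, with their
   1-based values, appear in this order in c. *)
Definition appears_before (c : seq 'I_n.-1) (j k : nat) : bool :=
  let values := [seq i.+1 | i : 'I_n.-1 <- c] in
  (index j values < index k values)%N.

End operators.

(** * Lattice paths *)

(* A path from L_0 to L_n, where L_a is the line x - y = a: both an east step
   and a south step increase x - y by one, so the path starts at a point
   (a, a) and has n steps, the j-th of which goes from L_j to L_{j+1} and is
   an east step when [is_east] holds and a south step otherwise. *)
Record lattice_path (n : nat) := LatticePath {
  path_start : int ;
  is_east : 'I_n -> bool }.

Definition coxeter_path (n : nat) (c : seq 'I_n.-1) : lattice_path n :=
  LatticePath 0 (fun j : 'I_n =>
    if j == 0%N :> nat then false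
    else if j == n.-1 :> nat then true
    else appears_before c j j.+1).

Section theta.
Context {R : realType}.
Variables (n : nat) (L : lattice_path n).

Definition vertex (k : nat) : R * R :=
  ((path_start L)%:~R + (\sum_(j < n | (j < k)%N) is_east L j)%:R,
   (path_start L)%:~R - (\sum_(j < n | (j < k)%N) ~~ is_east L j)%:R).

Definition scaled_path : set (R * R) :=
  [set p | exists (j : 'I_n) (t : R), 0 <= t <= 1 /\
    p = (((1 - t) * (vertex j).1 + t * (vertex j.+1).1) / n%:R,
         ((1 - t) * (vertex j).2 + t * (vertex j.+1).2) / n%:R)].

(* The j-th step is traversed while n z runs from j to j + 1, and [theta z] is
   the first coordinate of the point of the scaled path on x - y = z. *)
Definition theta (z : R) : R :=
  ((path_start L)%:~R +
   \sum_(j < n | is_east L j) Num.min 1 (Num.max 0 (n%:R * z - j%:R))) / n%:R.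

End theta.

(** * Permutons *)

Section permutons.
Context {R : realType}.
Notation lambda := (@lebesgue_measure R).
Notation plane := (measurableTypeR R * measurableTypeR R)%type.

Definition lambda2 : {measure set plane -> \bar R} := (lambda \x lambda)%E.

Definition unit_square : set (R * R) := `[0, 1] `*` `[0, 1].

Definition is_permuton (mu : set (R * R) -> \bar R) : Prop :=
  forall A : set R, measurable A ->
    mu (A `*` setT) = uniform_prob (@ltr01 R) A /\
    mu (setT `*` A) = uniform_prob (@ltr01 R) A.

Definition perm_square n (u : 'S_n) (i : 'I_n) : set (R * R) :=
  `[i%:R / n%:R, i.+1%:R / n%:R] `*` `[(u i)%:R / n%:R, (u i).+1%:R / n%:R].

Definition perm_support n (u : 'S_n) : set (R * R) :=
  \big[setU/set0]_(i < n) perm_square u i.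

Lemma measurable_perm_support n (u : 'S_n) : measurable (perm_support u).
Proof.
by apply: bigsetU_measurable => i _; apply: measurableX; exact: measurable_itv.
Qed.

Definition pi_perm n (u : 'S_n) : {measure set plane -> \bar R} :=
  mscale (n%:R)%:nng (mrestr lambda2 (measurable_perm_support u)).

End permutons.

(** * The permuton [nu] *)

Section nu.
Context {R : realType}.
Notation lambda := (@lebesgue_measure R).
Notation plane := (measurableTypeR R * measurableTypeR R)%type.

(* For a graph C = {(x, g x) : x in I}, the integral of w(x) dx over A n C. *)
Definition graph_integral (I : set R) (g w : R -> R) (A : set (R * R)) : \bar R :=
  (\int[lambda]_(x in I `&` [set x | A (x, g x)]) (w x)%:E)%E.

Section formula.
Variables alpha beta : R.

(* The quotients alpha / (1 - beta) and alpha / beta, equal to +oo when the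
   denominator is zero. *)
Definition quo1 : \bar R := (alpha%:E / (1 - beta)%:E)%E.
Definition quo0 : \bar R := (alpha%:E / beta%:E)%E.

Definition curve_se (x : R) : R := 1 - alpha / ((1 - beta) * (1 - x) + alpha).
Definition curve_nw (x : R) : R := alpha / (beta * x + alpha).

Definition dom_se : set R :=
  [set x | (maxe quo1 (1 - quo0) <= x%:E)%E /\ x <= 1].
Definition dom_nw : set R :=
  [set x | 0 <= x /\ (x%:E <= mine quo1 (1 - quo0))%E].
Definition dom_diag : set R :=
  [set x | 0 <= x <= 1 /\ (1 - quo0 <= x%:E <= quo1)%E].

Definition region_se : set (R * R) :=
  [set p | [/\ (quo1 <= p.1%:E)%E, p.1 <= 1, 0 <= p.2,
               (p.2%:E <= mine (1 - beta)%:E (1 - quo1))%E &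
               p.2 <= curve_se p.1]].
Definition region_nw : set (R * R) :=
  [set p | [/\ 0 <= p.1, (p.1%:E <= 1 - quo0)%E,
               (maxe (1 - beta)%:E quo0 <= p.2%:E)%E, p.2 <= 1 &
               curve_nw p.1 <= p.2]].

Definition nu_formula (A : set (R * R)) : \bar R :=
  (lambda2 (A `&` (region_se `|` region_nw)) +
   graph_integral dom_se curve_se (fun x => 1 - curve_se x)%R A +
   graph_integral dom_nw curve_nw curve_nw A +
   graph_integral dom_diag (fun x => 1 - x)%R (fun=> 1%R) A)%E.

End formula.

Section graph_integral_measure.
Variables (I : set R) (g w : R -> R).
Hypotheses (mI : measurable I) (mg : measurable_fun I g)
  (mw : measurable_fun I w) (w0 : forall x, I x -> 0 <= w x).

Lemma measurable_graph_preimage (A : set plane) : measurable A ->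
  measurable (I `&` [set x | A (x, g x)]).
Proof.
move=> mA; pose pt (x : measurableTypeR R) : plane := (x, (g \_ I) x).
have mpt : measurable_fun setT pt.
  apply: measurable_fun_pair; first exact: measurable_id.
  exact/(measurable_restrictT _ mI).
have -> : I `&` [set x | A (x, g x)] = I `&` pt @^-1` A.
  by apply/seteqP; split=> x [Ix]; rewrite /pt /= patchT ?inE.
by apply: measurableI => //; rewrite -[X in measurable X]setTI; exact: mpt.
Qed.

Lemma graph_integral0 : graph_integral I g w set0 = 0%E.
Proof.
rewrite /graph_integral (_ : _ `&` _ = set0) ?integral_set0//.
by rewrite -subset0 => x [].
Qed.

Lemma graph_integral_ge0 A : (0 <= graph_integral I g w A)%E.
Proof. by apply: integral_ge0 => x [Ix _]; rewrite lee_fin w0. Qed.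

Lemma graph_integral_sigma_additive :
  semi_sigma_additive (graph_integral I g w : set plane -> \bar R).
Proof.
move=> F mF tF mUF.
pose G k := I `&` [set x | F k (x, g x)].
have -> : graph_integral I g w (\bigcup_n F n) =
    (\sum_(0 <= i <oo) graph_integral I g w (F i))%E.
  rewrite /graph_integral.
  rewrite (_ : I `&` _ = \bigcup_k G k); last first.
    by apply/seteqP; split=> x [] => [Ix [k _ Fk]|k _ [Ix Fk]];
      [exists k|split => //; exists k].
  rewrite ge0_integral_bigcup//.
  - by move=> k; exact: measurable_graph_preimage.
  - apply: (@measurable_funS _ _ _ _ I) => //; first by move=> x [k _ []].
    exact/measurable_EFinP.
  - by move=> x [k _ [Ix _]]; rewrite lee_fin w0.
  - apply/trivIsetP => i j _ _ ij; rewrite -subset0 => x [[_ Fi] [_ Fj]].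
    have /trivIsetP/(_ i j Logic.I Logic.I ij)/seteqP[+ _] := tF.
    by move=> /(_ (x, g x)); apply.
by apply: is_cvg_nneseries => k _ _; exact: graph_integral_ge0.
Qed.

End graph_integral_measure.

Section nu_measure.
Variables alpha beta : R.
Hypotheses (alpha_gt0 : 0 < alpha) (beta01 : 0 <= beta <= 1).

Let measurable_ege (e : \bar R) : measurable [set x : R | (e <= x%:E)%E].
Proof.
rewrite -[X in measurable X]setTI; apply: emeasurable_fun_c_infty => //.
Qed.

Let measurable_ele (e : \bar R) : measurable [set x : R | (x%:E <= e)%E].
Proof.
rewrite -[X in measurable X]setTI; apply: emeasurable_fun_infty_c => //.
Qed.

Lemma denom_se_gt0 (x : R) : x <= 1 -> 0 < (1 - beta) * (1 - x) + alpha.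
Proof.
by case/andP: beta01 => b0 b1 x1; apply: ltr_wpDl => //; apply: mulr_ge0; lra.
Qed.

Lemma denom_nw_gt0 (x : R) : 0 <= x -> 0 < beta * x + alpha.
Proof.
by case/andP: beta01 => b0 b1 x0; apply: ltr_wpDl => //; exact: mulr_ge0.
Qed.

Lemma measurable_curve_se : measurable_fun (`]-oo, 1] : set R) (curve_se alpha beta).
Proof.
apply: subspace_continuous_measurable_fun; first exact: measurable_itv.
apply: continuous_in_subspaceT => x; rewrite inE /= in_itv /= => x1.
apply: cvgB; first exact: cvg_cst.
apply: cvgM; first exact: cvg_cst.
apply: cvgV; first by rewrite gt_eqF// denom_se_gt0.
apply: cvgD; last exact: cvg_cst.
apply: cvgM; first exact: cvg_cst.
by apply: cvgB; [exact: cvg_cst|exact: cvg_id].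
Qed.

Lemma measurable_curve_nw : measurable_fun (`[0, +oo[ : set R) (curve_nw alpha beta).
Proof.
apply: subspace_continuous_measurable_fun; first exact: measurable_itv.
apply: continuous_in_subspaceT => x; rewrite inE /= in_itv /= andbT => x0.
apply: cvgM; first exact: cvg_cst.
apply: cvgV; first by rewrite gt_eqF// denom_nw_gt0.
apply: cvgD; last exact: cvg_cst.
by apply: cvgM; [exact: cvg_cst|exact: cvg_id].
Qed.

Lemma measurable_dom_se : measurable (dom_se alpha beta).
Proof.
apply: measurableI; first exact: measurable_ege.
by rewrite -[X in measurable X]set_itvNyc; exact: measurable_itv.
Qed.

Lemma measurable_dom_nw : measurable (dom_nw alpha beta).
Proof.
apply: measurableI; last exact: measurable_ele.
by rewrite -[X in measurable X]set_itvcy; exact: measurable_itv.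
Qed.

Lemma measurable_dom_diag : measurable (dom_diag alpha beta).
Proof.
rewrite (_ : dom_diag _ _ = `[0, 1] `&` ([set x | (1 - quo0 alpha beta <= x%:E)%E]
   `&` [set x | (x%:E <= quo1 alpha beta)%E])).
  by apply: measurableI; [exact: measurable_itv|exact: measurableI].
by apply/seteqP; split=> x /=; rewrite in_itv/= => -[x01];
  [move=> /andP[]|move=> [? ?]; split => //; exact/andP].
Qed.

Lemma measurable_region_se : measurable (region_se alpha beta : set plane).
Proof.
pose P := [set x : measurableTypeR R | (quo1 alpha beta <= x%:E)%E] `&` `]-oo, 1].
pose Q := `[0, +oo[ `&` [set y : measurableTypeR R |
  (y%:E <= mine (1 - beta)%:E (1 - quo1 alpha beta))%E].
have mPQ : measurable (P `*` Q).
  by apply: measurableX; apply: measurableI;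
    by [exact: measurable_ege|exact: measurable_ele|exact: measurable_itv].
have -> : region_se alpha beta =
    (P `*` Q) `&` [set p | p.2 <= curve_se alpha beta p.1].
  apply/seteqP; split=> -[x y]; rewrite /P /Q /= !in_itv/= ?andbT.
    by case.
  by case=> -[[? ?] [? ?]] ?.
apply: measurable_fun_le => //.
  by apply: measurable_funTS; exact: measurable_snd.
have mfst : measurable_fun (P `*` Q) (fst : plane -> measurableTypeR R).
  by apply: measurable_funTS; exact: measurable_fst.
apply: (measurable_comp (measurable_itv `]-oo, 1]) _ measurable_curve_se mfst).
by move=> _ [[x y] [[_ /= x1] _] <-].
Qed.

Lemma measurable_region_nw : measurable (region_nw alpha beta : set plane).
Proof.
pose P := `[0, +oo[ `&` [set x : measurableTypeR R |
  (x%:E <= 1 - quo0 alpha beta)%E].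
pose Q := [set y : measurableTypeR R |
  (maxe (1 - beta)%:E (quo0 alpha beta) <= y%:E)%E] `&` `]-oo, 1].
have mPQ : measurable (P `*` Q).
  by apply: measurableX; apply: measurableI;
    by [exact: measurable_ege|exact: measurable_ele|exact: measurable_itv].
have -> : region_nw alpha beta =
    (P `*` Q) `&` [set p | curve_nw alpha beta p.1 <= p.2].
  apply/seteqP; split=> -[x y]; rewrite /P /Q /= !in_itv/= ?andbT.
    by case.
  by case=> -[[? ?] [? ?]] ?.
apply: measurable_fun_le => //.
  have mfst : measurable_fun (P `*` Q) (fst : plane -> measurableTypeR R).
    by apply: measurable_funTS; exact: measurable_fst.
  apply: (measurable_comp (measurable_itv `[0, +oo[) _ measurable_curve_nw mfst).
  by move=> _ [[x y] [[/= x0 _] _] <-].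
by apply: measurable_funTS; exact: measurable_snd.
Qed.

Lemma dom_se_le1 : dom_se alpha beta `<=` `]-oo, 1].
Proof. by move=> x []; rewrite /= in_itv. Qed.

Lemma dom_nw_ge0 : dom_nw alpha beta `<=` `[0, +oo[.
Proof. by move=> x []; rewrite /= in_itv/= andbT. Qed.

Lemma curve_se_le1 x : x <= 1 -> 0 <= 1 - curve_se alpha beta x.
Proof.
by move=> x1; rewrite /curve_se subKr divr_ge0 ?ltW// denom_se_gt0.
Qed.

Lemma curve_nw_ge0 x : 0 <= x -> 0 <= curve_nw alpha beta x.
Proof. by move=> x0; rewrite divr_ge0 ?ltW// denom_nw_gt0. Qed.

End nu_measure.

Definition nu (alpha beta : R) (alpha_gt0 : 0 < alpha)
    (beta01 : 0 <= beta <= 1) : set plane -> \bar R :=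
  nu_formula alpha beta.

Section nu_instance.
Variables (alpha beta : R) (alpha_gt0 : 0 < alpha) (beta01 : 0 <= beta <= 1).
Local Notation nu := (nu alpha_gt0 beta01).

Let nu0 : nu set0 = 0%E.
Proof. by rewrite /nu /nu_formula set0I measure0 !graph_integral0 !adde0. Qed.

Let wse_ge0 x : dom_se alpha beta x -> 0 <= 1 - curve_se alpha beta x.
Proof. by move=> [_ x1]; exact: curve_se_le1. Qed.

Let wnw_ge0 x : dom_nw alpha beta x -> 0 <= curve_nw alpha beta x.
Proof. by move=> [x0 _]; exact: curve_nw_ge0. Qed.

Let nu_ge0 A : (0 <= nu A)%E.
Proof.
by do 3 (apply: adde_ge0; last by exact: graph_integral_ge0); exact: measure_ge0.
Qed.

Let nu_sigma_additive : semi_sigma_additive nu.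
Proof.
have mU : measurable (region_se alpha beta `|` region_nw alpha beta : set plane).
  by apply: measurableU; [exact: measurable_region_se|exact: measurable_region_nw].
have mse := measurable_funS (measurable_itv _) (@dom_se_le1 alpha beta)
  (measurable_curve_se alpha_gt0 beta01).
have mnw := measurable_funS (measurable_itv _) (@dom_nw_ge0 alpha beta)
  (measurable_curve_nw alpha_gt0 beta01).
move=> F mF tF mUF; rewrite /nu /nu_formula.
under eq_fun do rewrite 3!big_split/=.
have addd (a b : \bar R) : (0 <= a)%E -> (0 <= b)%E -> (a +? b)%E.
  by move=> a0 b0; apply: ge0_adde_def; rewrite inE.
apply: cvgeD.
- apply: addd; last exact: graph_integral_ge0.
  do 2 (apply: adde_ge0; last by exact: graph_integral_ge0).
  exact: measure_ge0.
- apply: cvgeD.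
  + apply: addd; last exact: graph_integral_ge0.
    apply: adde_ge0; last exact: graph_integral_ge0.
    exact: measure_ge0.
  + apply: cvgeD.
    * by apply: addd; [exact: measure_ge0|exact: graph_integral_ge0].
    * pose m : {measure set plane -> \bar R} := mrestr lambda2 mU.
      exact: (@measure_semi_sigma_additive _ _ _ m F mF tF mUF).
    * apply: graph_integral_sigma_additive => //.
      - exact: measurable_dom_se.
      - by apply: measurable_funB => //; exact: measurable_cst.
  + by apply: graph_integral_sigma_additive => //; exact: measurable_dom_nw.
- apply: graph_integral_sigma_additive => //.
  + exact: measurable_dom_diag.
  + by apply: measurable_funB => //; exact: measurable_cst.
Qed.

HB.instance Definition _ := isMeasure.Build _ _ _ nu nu0 nu_ge0 nu_sigma_additive.

End nu_instance.
End nu.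

(** * Weak convergence of random permutons *)

Section weak_convergence.
Context {R : realType}.
Notation plane := (measurableTypeR R * measurableTypeR R)%type.

Definition uniform_pr (T : finType) (E : {set T}) : R := #|E|%:R / #|T|%:R.

Definition cvg_weakly_in_probability (T : nat -> finType)
    (X : forall n, T n -> {measure set plane -> \bar R})
    (mu : {measure set plane -> \bar R}) : Prop :=
  forall f : R * R -> R, {within unit_square, continuous f} ->
  forall e : R, 0 < e ->
    uniform_pr [set v : T n | e <= `| \int[X n v]_(p in unit_square) f p -
                                    \int[mu]_(p in unit_square) f p |]%SET
      @[n --> \oo] --> 0.

End weak_convergence.

(* Main.v *)
Require Import Defs.
From HB Require Import structures.
From mathcomp Require Import all_boot all_order all_algebra all_fingroup.
From mathcomp Require Import all_classical all_reals all_analysis.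
From mathcomp Require Import measurable_realfun zify ring lra.

(* Fix a threshold m and call a value small when it is less than m; let h(i) be
   the number of small values among the first i positions.  The operator tau_i
   replaces h(i) by max (h(i - 1), h(i + 1) - 1) and leaves the rest of h
   unchanged, so a power of a Coxeter word acts on h as a max-plus linear map.
   Its matrix is explicit: a path using p left moves and q right moves leads
   from time t at i back to time 0 at a exactly when p = t + E(i) - E(a) and
   q = t + S(a) - S(i), where E and S count the east and south steps of the
   lattice path, and it costs q.  Hence

     h_t(i) = max (0, m - (n - i), max_a (h_0(a) - (t + S(a) - S(i)))),

   a ranging over the positions for which p and q are nonnegative.  By
   Chebyshev's inequality h_0(a) is close to a m / n, and E(a) is close to
   beta a by hypothesis, so after scaling the maximum becomes a linear program
   in one variable.  Its value is the height function of nu, because the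
   conditional distributions of nu on vertical lines give to [0, y] one of the
   masses 0, y, 1, which are the slopes of that value. *)

Set Implicit Arguments.
Unset Strict Implicit.
Unset Printing Implicit Defensive.

Import Order.TTheory GRing.Theory Num.Theory.
Import numFieldNormedType.Exports.

Local Open Scope nat_scope.

(** * Max-plus recursion for the height *)

(** Two conserved quantities make the matrix explicit. A letter reads a neighbour already updated in
    the same sweep exactly when the neighbour's letter comes earlier, which the steps of the lattice
    path record; hence a left move lowers t + E(i) by one and keeps t - S(i), while a right move
    keeps t + E(i) and lowers t - S(i) by one. All paths between two given points cost the same, and
    a maximum over paths becomes one over endpoints. Chebyshev's inequality gives a bound of order
    1/n at one position, too weak for a union over all n + 1 positions. Heights and step counts
    change by at most one per position, so finitely many positions, their number independent of n,
    control the others. Weak convergence also needs only finitely many heights: the integral of a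
    continuous function is close to a sum over the cells of a fixed grid, whose masses are mixed
    second differences of heights. The curves and the segment of nu are the places where two terms
    of a maximum in the limiting height exchange, and the density they carry is the jump of its
    slope in x. *)

Definition count_upto (f : nat -> bool) (i : nat) : nat := \sum_(0 <= j < i) f j.

Lemma count_upto0 f : count_upto f 0 = 0.
Proof. by rewrite /count_upto big_nil. Qed.

Lemma count_uptoS f i : count_upto f i.+1 = count_upto f i + f i.
Proof. by rewrite /count_upto big_nat_recr. Qed.

Lemma count_upto_mono (f : nat -> bool) i j : i <= j ->
  count_upto f i <= count_upto f j.
Proof. by move=> ij; rewrite /count_upto [leqRHS](@big_cat_nat _ _ _ i)//= leq_addr. Qed.

Lemma count_uptoC (f : nat -> bool) i :
  count_upto f i + count_upto (fun j => ~~ f j) i = i.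
Proof.
rewrite /count_upto -big_split /= (eq_bigr (fun=> 1)); last by move=> j _; case: (f j).
by rewrite sum_nat_const_nat subn0 muln1.
Qed.

Section height_recursion.
Variables (n m : nat) (e : nat -> bool) (h : nat -> nat -> nat).
Local Notation E := (count_upto e).
Local Notation S := (count_upto (fun j => ~~ e j)).
Hypothesis h_left : forall t, h t 0 = 0.
Hypothesis h_right : forall t, h t n = m.
Hypothesis h_step : forall i, i < n -> h 0 i <= h 0 i.+1 <= (h 0 i).+1.
Hypothesis h_rec : forall t i, 0 < i < n ->
  h t.+1 i = maxn (h (t + e i.-1) i.-1) (h (t + ~~ e i) i.+1 - 1).

Lemma initial_height_lip i d : i + d <= n -> h 0 i <= h 0 (i + d) <= h 0 i + d.
Proof.
elim: d => [|d IH] id; first by rewrite !addn0 leqnn.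
have /andP[? ?] := IH (ltac:(lia)).
have /andP[] := @h_step (i + d) (ltac:(lia)); rewrite addnS; lia.
Qed.

Lemma initial_height_le i j : i <= j <= n -> h 0 i <= h 0 j <= h 0 i + (j - i).
Proof.
move=> ij; have := @initial_height_lip i (j - i) (ltac:(lia)).
by rewrite subnKC //; lia.
Qed.

(* [p] and [q] count the left and the right moves of a path from time [t] at [i]
   back to time 0 at [a]; every move decreases [p + q]. *)
Lemma height_lower t i a p q : i <= n -> a <= n ->
  t + E i = p + E a -> t + S a = q + S i -> h 0 a <= h t i + q.
Proof.
have [N] := ubnP (p + q); elim: N t i p q => // N IH t i p q pqN iN aN pE qE.
have Ei := (count_uptoC e) i; have Ea := (count_uptoC e) a.
have haa := @initial_height_le a n; rewrite h_right in haa.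
have h0a := @initial_height_le 0 a; rewrite h_left in h0a.
(* Position 0 may be reached with moves left over; then q = p + a, and [h 0 a] is at most a. *)
have [i0|i0] := posnP i.
  by subst i; rewrite h_left; move: pE qE Ei; rewrite !count_upto0; lia.
have [iltn|] := ltnP i n; last first.
  move=> ni; have -> : i = n by lia.
  rewrite h_right; lia.
(* At time 0 the moves left over all go one way, because E and S are monotone: to the left if a <=
   i, where [h 0] is nondecreasing, and otherwise to the right, with q = a - i the most by which
   [h 0] can grow. *)
case: t pE qE => [|t] pE qE.
  have [ai|ia] := leqP a i.
    have := @initial_height_le a i; lia.
  have := @initial_height_le i a; lia.
rewrite h_rec ?i0//.
case: p pqN pE => [|p] pqN pE.
  case: q pqN qE => [|q] pqN qE.
    have [ai|ia] := leqP a i.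
      by have := count_upto_mono e ai; lia.
    by have := @count_upto_mono (fun j => ~~ e j) _ _ (ltnW ia); lia.
  have := IH (t + ~~ e i) i.+1 0 q; rewrite !count_uptoS. lia.
have := IH (t + e i.-1) i.-1 p q.
have := (count_uptoS e) i.-1; have := (count_uptoS (fun j => ~~ e j)) i.-1;
  rewrite prednK// => Si1 Ei1.
lia.
Qed.

(** The larger branch of [h_rec], followed backwards, traces a path. It ends at position 0, where
    the height is 0, or at position n, where the height is m and at least n - i right moves have
    been paid for, or at time 0. *)
Lemma height_upper t i : i <= n ->
  [\/ h t i = 0, h t i + n <= m + i |
    exists a p q, [/\ a <= n, t + E i = p + E a, t + S a = q + S i &
      h t i + q <= h 0 a]].
Proof.
(* The sum of t + E(i) and t + n - S(i), which every move lowers by one. The time alone may stay the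
   same, when the neighbour read has already been updated. *)
have [N] := ubnP (2 * t + E i + (n - S i)).
elim: N t i => // N IH t i tN iN.
have [i0|i0] := posnP i; first by apply: Or31; rewrite i0 h_left.
have [iltn|] := ltnP i n; last first.
  by move=> ni; apply: Or32; rewrite (_ : i = n) ?h_right//; lia.
case: t tN => [|t] tN.
  by apply: Or33; exists i, 0, 0; split=> //; rewrite addn0.
have Ei := (count_uptoC e) i; have EiS := (count_uptoC e) i.+1.
rewrite !(count_uptoS) in EiS.
have := @h_rec t i; rewrite i0 iltn => /(_ isT) ->.
case: (leqP (h (t + e i.-1) i.-1) (h (t + ~~ e i) i.+1 - 1)) => _.
  have := IH (t + ~~ e i) i.+1; rewrite !count_uptoS.
  case=> [||->|hn|[a [p [q [aN pE qE hq]]]]]; [lia|lia|exact: Or31| |].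
    (* If the height read is 0, the truncated subtraction gives 0; otherwise it is a true
       subtraction. *)
    have [->|h0] := posnP (h (t + ~~ e i) i.+1); first exact: Or31.
    by apply: Or32; lia.
  have [->|h0] := posnP (h (t + ~~ e i) i.+1); first exact: Or31.
  by apply: Or33; exists a, p, q.+1; split => //; lia.
have := IH (t + e i.-1) i.-1.
have := (count_uptoS e) i.-1; have := (count_uptoS (fun j => ~~ e j)) i.-1;
  rewrite prednK// => Si1 Ei1.
case=> [||->|hn|[a [p [q [aN pE qE hq]]]]]; [lia|lia|exact: Or31| |].
  by apply: Or32; lia.
by apply: Or33; exists a, p.+1, q; split => //; lia.
Qed.

End height_recursion.

(** * Heights of permutations under a sweep *)

Section heights.
Variables (n m : nat).
Implicit Type u : 'S_n.

Definition height u (i : nat) : nat := \sum_(p < n | p < i) (u p < m).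

Lemma height0 u : height u 0 = 0.
Proof. by rewrite /height big_pred0. Qed.

Lemma heightS u (p : 'I_n) : height u p.+1 = height u p + (u p < m).
Proof.
rewrite /height (bigD1 p)//= addnC; congr (_ + _).
by apply: eq_bigl => q; rewrite ltnS ltn_neqAle andbC -val_eqE.
Qed.

Lemma height_step u i : i < n -> height u i <= height u i.+1 <= (height u i).+1.
Proof. by move=> ilt; rewrite (heightS u (Ordinal ilt)); case: (_ < m) => /=; lia. Qed.

Lemma height_full u : height u n = minn m n.
Proof.
rewrite /height; under eq_bigl do rewrite ltn_ord.
rewrite (reindex_inj (@perm_inj _ u^-1%g)) /=.
under eq_bigr do rewrite permKV.
rewrite -[RHS]card_ord -sum1_card (big_ord_widen n (fun=> 1) (geq_minr m n))
  [RHS]big_mkcond /=.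
by apply: eq_bigr => p _; rewrite leq_min ltn_ord andbT; case: (p < m).
Qed.

(** At most n - i of the m small values lie beyond the first i positions. *)
Lemma height_ge u i : m <= n -> i <= n -> m + i <= height u i + n.
Proof.
move=> mn iN; rewrite -(subKn iN); have := leq_subr i n.
elim: (n - i) => [|k IH] kn; first by rewrite subn0 height_full (minn_idPl mn); lia.
have := IH (ltnW kn); have := height_step u (ltac:(lia) : n - k.+1 < n).
by rewrite (_ : (n - k.+1).+1 = n - k); lia.
Qed.

(** Only the prefix that separates the two positions can change its count. After sorting in
    decreasing order its last entry is small exactly when both entries are, that is, when the
    heights on the two sides differ by 2; only then does the second term of the maximum win. *)
Lemma height_tau u (j : 'I_n.-1) i : height (tau j u) i =
  if i == j.+1 then maxn (height u j) (height u j.+2 - 1) else height u i.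
Proof.
pose l := posl j; pose r := posr j.
have jl : j = l :> nat by []. have jr : j.+1 = r :> nat by [].
have off k : k != j.+1 -> height (tau j u) k = height u k.
  move=> kj; rewrite /tau; case: ifP => // _.
  rewrite /height (reindex_inj (@perm_inj _ (tperm l r))) /=.
  apply: eq_big => p; last by rewrite permM tpermK.
  by case: tpermP => // ->; lia.
case: eqP => [->|/eqP]; last exact: off.
have t1 : height (tau j u) j.+1 = height u j + (tau j u l < m).
  by rewrite [in LHS]jl heightS off//; lia.
have t2 : height u j.+2 = height u j + (u l < m) + (u r < m).
  by rewrite [in LHS]jr heightS -jr [in LHS]jl heightS.
rewrite t1 t2 /tau -/l -/r; case: ifP => ur; last first.
  by case: ltnP => /=; case: ltnP => /=; lia.
by rewrite permM tpermL; case: ltnP => /=; case: ltnP => /=; lia.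
Qed.

Lemma height_tau_word_notin (w : seq 'I_n.-1) u i :
  i \notin [seq j.+1 | j : 'I_n.-1 <- w] -> height (tau_word w u) i = height u i.
Proof.
elim: w u => //= j w IH u; rewrite inE negb_or => /andP[ij iw].
by rewrite IH// height_tau (negbTE ij).
Qed.

Lemma tau_word_cat (w1 w2 : seq 'I_n.-1) u :
  tau_word (w1 ++ w2) u = tau_word w2 (tau_word w1 u).
Proof. exact: foldl_cat. Qed.

(* The steps of the path, extended by [false] to all of [nat]. *)
Definition before (c : seq 'I_n.-1) (i : nat) : bool :=
  oapp (is_east (coxeter_path c)) false (insub i).

Lemma beforeE (c : seq 'I_n.-1) (i : 'I_n) :
  before c i = is_east (coxeter_path c) i.
Proof. by rewrite /before valK. Qed.

(** Each letter occurs once, so when the letter of position i acts, a neighbouring height already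
    has its final value in the sweep if its letter came before, and still has its initial value
    otherwise. *)
Lemma height_sweep (c : seq 'I_n.-1) u i : coxeter_word c -> 0 < i < n ->
  height (tau_word c u) i =
    maxn (height (if before c i.-1 then tau_word c u else u) i.-1)
         (height (if before c i then u else tau_word c u) i.+1 - 1).
Proof.
move=> cox /andP[i0 iln].
have jlt : i.-1 < n.-1 by lia.
pose j := Ordinal jlt; have ij : j.+1 = i by rewrite /=; lia.
pose values (w : seq 'I_n.-1) := [seq k.+1 | k : 'I_n.-1 <- w].
have jc : j \in c by rewrite -has_pred1 has_count cox.
have uc : uniq (values c).
  rewrite map_inj_uniq; last by move=> a b [] /val_inj.
  by apply: count_mem_uniq => k; rewrite cox -has_pred1 has_count cox.
have [c1 [c2 defc]] : exists c1 c2, c = c1 ++ j :: c2.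
  by move: jc; clear; case/splitPr=> c1 c2; exists c1, c2.
have vc : values c = values c1 ++ i :: values c2 by rewrite defc /values map_cat /= prednK.
move: uc; rewrite vc cat_uniq /= negb_or => /and3P[_ /andP[i1 /hasPn v12] /andP[i2 _]].
have wE k : height (tau_word c1 u) k =
    height (if k \in values c1 then tau_word c u else u) k.
  case: ifP => k1; last by rewrite height_tau_word_notin// k1.
  rewrite defc tau_word_cat [RHS]height_tau_word_notin//= inE prednK//.
  apply/norP; split; last by apply: contraTN k1 => /v12.
  by apply: contraTneq k1 => ->.
have -> : height (tau_word c u) i =
    maxn (height (tau_word c1 u) i.-1) (height (tau_word c1 u) i.+1 - 1).
  rewrite defc tau_word_cat /= height_tau_word_notin//.
  by rewrite height_tau ij eqxx.
have idx : index i (values c) = size (values c1) by rewrite vc index_pivot.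
congr (maxn _ (_ - 1)); rewrite wE.
  (* No letter moves the heights at 0 and n, so there the conventional first and last steps of the
     path are harmless: both alternatives have the same height. *)
  have [->|k0] := eqVneq i.-1 0; first by rewrite !height0.
  have klt : i.-1 < n by lia.
  have -> : before c i.-1 = appears_before c i.-1 i.
    rewrite -[i.-1]/(val (Ordinal klt)) beforeE /= (negbTE k0) prednK//.
    by case: eqP => //; lia.
  rewrite /appears_before -/(values c) idx vc index_cat.
  by case: ifP => k1; rewrite ?index_mem ?k1// ltnNge leq_addr.
have [->|k0] := eqVneq i.+1 n.
  by case: ifP; case: ifP; rewrite // !height_full.
have -> : before c i = appears_before c i i.+1.
  rewrite -[i]/(val (Ordinal iln)) beforeE /= -[i == 0]/(i == 0) gtn_eqF//.
  by case: eqP => //; lia.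
rewrite /appears_before -/(values c) idx vc index_cat.
case: ifP => k1; first by rewrite ltnNge ltnW ?index_mem.
by rewrite /= -[i == i.+1]/(i == i.+1) ltn_eqF// addnS ltnS leq_addr.
Qed.
End heights.

Section iterated_sweeps.
Variables (n m : nat) (c : seq 'I_n.-1) (v : 'S_n).
Hypotheses (cox : coxeter_word c) (mn : m <= n).
Local Notation h := (fun t => height m (iter t (tau_word c) v)).
Local Notation E := (count_upto (before c)).
Local Notation S := (count_upto (fun j => ~~ before c j)).

Let h_rec t i : 0 < i < n ->
  h t.+1 i = maxn (h (t + before c i.-1) i.-1) (h (t + ~~ before c i) i.+1 - 1).
Proof.
move=> i0n; rewrite /= (height_sweep _ _ cox i0n).
by case: (before c i.-1); case: (before c i); rewrite /= ?addn0 ?addn1.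
Qed.

Lemma sweeps_lower t i a p q : i <= n -> a <= n ->
  t + E i = p + E a -> t + S a = q + S i -> height m v a <= h t i + q.
Proof.
apply: (@height_lower n m (before c) h) => //.
- by move=> s; exact: height0.
- by move=> s; rewrite height_full; exact/minn_idPl.
- by move=> j jn; exact: height_step.
Qed.

Lemma sweeps_upper t i : i <= n ->
  [\/ h t i = 0, h t i + n <= m + i |
    exists a p q, [/\ a <= n, t + E i = p + E a, t + S a = q + S i &
      h t i + q <= height m v a]].
Proof.
apply: (@height_upper n m (before c) h) => //.
- by move=> s; exact: height0.
- by move=> s; rewrite height_full; exact/minn_idPl.
Qed.

End iterated_sweeps.

Local Open Scope classical_set_scope.
Local Open Scope ring_scope.

(** * Concentration of the initial height *)

Section random_height.
Variables (R : realType) (n m : nat).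
Hypotheses (n_gt0 : (0 < n)%N) (mn : (m <= n)%N).

Definition centered (p : 'I_n) (v : 'S_n) : R := (v p < m)%N%:R - m%:R / n%:R.

Let n0 : n%:R != 0 :> R. Proof. by rewrite pnatr_eq0 -lt0n. Qed.

Lemma height_centered (v : 'S_n) a : (a <= n)%N ->
  (height m v a)%:R - a%:R * (m%:R / n%:R) = \sum_(p < n | (p < a)%N) centered p v.
Proof.
move=> an; rewrite sumrB -natr_sum; congr (_ - _).
by rewrite -(big_ord_widen n (fun=> m%:R / n%:R) an) sumr_const card_ord mulr_natl.
Qed.

Lemma sum_centered (v : 'S_n) : \sum_p centered p v = 0.
Proof.
have := height_centered v (leqnn n); rewrite height_full (minn_idPl mn).
rewrite mulrCA divff// mulr1 subrr => H; rewrite [RHS]H.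
by apply: eq_big => // p; rewrite ltn_ord.
Qed.

Lemma centered_sqr_le1 p (v : 'S_n) : centered p v ^+ 2 <= 1.
Proof.
have : 0 <= (m%:R / n%:R : R) <= 1.
  by rewrite divr_ge0// ler_pdivrMr ?ltr0n// mul1r ler_nat.
by rewrite /centered; case: (_ < _)%N => /=; nra.
Qed.

(* The centered variables sum to 0 and are exchangeable, so the common value of
   the covariances of [p] with the other positions is minus a variance divided
   by [n - 1]. *)
Lemma covariance_le0 p q : p != q ->
  \sum_(v : 'S_n) centered p v * centered q v <= 0.
Proof.
move=> pq; pose cov q := \sum_(v : 'S_n) centered p v * centered q v.
have sym q' : q' != p -> cov q' = cov q.
  move=> q'p; rewrite /cov (reindex_inj (mulgI (tperm q q'))) /=.
  apply: eq_bigr => v _; rewrite /centered !permM tpermR tpermD//.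
  by rewrite eq_sym.
have : \sum_q' cov q' = 0.
  rewrite /cov exchange_big /= big1// => v _.
  by rewrite -mulr_sumr sum_centered mulr0.
rewrite (bigD1 p)//= (eq_bigr (fun=> cov q)); last by move=> q' /sym.
rewrite sumr_const => /eqP; rewrite addr_eq0 => /eqP cpp.
have cpp0 : 0 <= cov p by apply: sumr_ge0 => v _; rewrite -expr2 sqr_ge0.
rewrite leNgt; apply/negP; rewrite -/(cov q) => cq.
have c0 : (0 < #|[pred q' | q' != p]|)%N.
  by apply/card_gt0P; exists q; rewrite inE eq_sym.
move: cpp0; rewrite cpp oppr_ge0 leNgt => /negP; apply.
by rewrite pmulrn_lgt0.
Qed.

(** Expanding the square, the a diagonal terms are at most 1 on average and the covariances are
    nonpositive, so the variance is at most a, as for independent variables. *)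
Lemma height_second_moment a : (a <= n)%N ->
  \sum_(v : 'S_n) ((height m v a)%:R - a%:R * (m%:R / n%:R)) ^+ 2
    <= n%:R * #|'S_n|%:R :> R.
Proof.
move=> an.
under eq_bigr do rewrite height_centered// expr2 mulr_suml.
rewrite exchange_big /=.
have -> : n%:R * #|'S_n|%:R = \sum_(p < n) #|'S_n|%:R :> R.
  by rewrite sumr_const card_ord mulr_natl.
rewrite [leRHS](bigID (fun p : 'I_n => p < a)%N) /= -[leLHS]addr0 lerD//; last first.
  by apply: sumr_ge0.
apply: ler_sum => p pa; under eq_bigr do rewrite mulr_sumr.
rewrite exchange_big /= (bigD1 p)//= -[leRHS]addr0 lerD//.
  rewrite -sum1_card natr_sum; apply: ler_sum => v _.
  by rewrite -expr2 centered_sqr_le1.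
by apply: sumr_le0 => q /andP[_ qp]; apply: covariance_le0; rewrite eq_sym.
Qed.

Lemma height_deviation a (d : R) : (a <= n)%N -> 0 < d ->
  uniform_pr [set v : 'S_n |
    d * n%:R <= `|(height m v a)%:R - a%:R * (m%:R / n%:R)| ]%SET
  <= (d ^+ 2 * n%:R)^-1 :> R.
Proof.
move=> an d0; rewrite /uniform_pr; set B := [set v | _]%SET.
have S0 : 0 < #|'S_n|%:R :> R by rewrite ltr0n; apply/card_gt0P; exists 1%g.
have nR0 : 0 < n%:R :> R by rewrite ltr0n.
have := height_second_moment an => sm.
have : #|B|%:R * (d * n%:R) ^+ 2 <= n%:R * #|'S_n|%:R.
  apply: le_trans sm; rewrite (bigID (mem B)) /= -[leLHS]addr0 lerD//; last first.
    by apply: sumr_ge0 => v _; exact: sqr_ge0.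
  rewrite -sum1_card natr_sum mulr_suml; apply: ler_sum => v; rewrite inE mul1r => dv.
  rewrite -[leRHS]real_normK ?num_real// lerXn2r// ?nnegrE//.
  by rewrite mulr_ge0// ltW.
move=> H; rewrite ler_pdivrMr// ler_pdivlMl ?mulr_gt0 ?exprn_gt0//.
by rewrite -(ler_pM2l nR0); apply: le_trans H; rewrite exprMn; lra.
Qed.

End random_height.

(** * The limiting height function *)

Section limit_height.
Variables (R : realType) (alpha beta : R).

(** The larger of 0, x + y - 1 and the maximum of y A - (alpha + (1 - beta) (A - x)) over A in
    [0, 1] with alpha + beta (x - A) >= 0 and alpha + (1 - beta) (A - x) >= 0. The objective has
    slope y - (1 - beta) in A, so the sign of this slope selects the vertex: A = min(1, x + alpha /
    beta) or A = max(0, x - alpha / (1 - beta)). The vertices 1 and 0 give values at most x + y - 1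
    and 0, which explains the branches without a quotient. *)
Definition limit_height (x y : R) : R :=
  if 1 - beta <= y then
    if beta * (1 - x) <= alpha then Num.max 0 (x + y - 1)
    else Num.max 0 (y * x - (1 - y) * (alpha / beta))
  else
    if (1 - beta) * x <= alpha then Num.max 0 (x + y - 1)
    else Num.max (y * (x - alpha / (1 - beta))) (x + y - 1).

Lemma beta_gt0_of_zone (x : R) : 0 < alpha -> 0 <= beta ->
  ~~ (beta * (1 - x) <= alpha) -> 0 < beta.
Proof.
move=> alpha_gt0 beta_ge0; rewrite lt_neqAle beta_ge0 andbT; apply: contraNneq => <-.
by rewrite mul0r ltW.
Qed.

(* The inverse of 0 is 0, which removes the terms of the degenerate cases
   [beta = 0] and [beta = 1], where they are not needed. *)
Definition limit_height_slack : R := 6%:R * (1 + beta^-1 + (1 - beta)^-1).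

Lemma limit_height_slack_ge : 0 <= beta <= 1 ->
  [/\ 6%:R <= limit_height_slack, 6%:R / beta <= limit_height_slack &
      6%:R / (1 - beta) <= limit_height_slack].
Proof.
move=> /andP[beta_ge0 beta_le1].
have b0 : 0 <= beta^-1 by rewrite invr_ge0 ?subr_ge0.
have b1 : 0 <= (1 - beta)^-1 by rewrite invr_ge0 ?subr_ge0.
by rewrite /limit_height_slack; split; lra.
Qed.

Lemma limit_height_ge (x y : R) :
  0 < alpha -> 0 <= beta <= 1 -> 0 <= x <= 1 -> 0 <= y <= 1 ->
  0 <= limit_height x y /\ x + y - 1 <= limit_height x y.
Proof.
move=> alpha_gt0 beta01 /andP[x_ge0 x_le1] /andP[y_ge0 y_le1].
have /andP[beta_ge0 beta_le1] := beta01.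
rewrite /limit_height; case: ifPn => yb; case: ifPn => xa; rewrite !le_max ?lexx ?orbT//.
  split; first by [].
  have b0 := beta_gt0_of_zone alpha_gt0 beta_ge0 xa.
  apply/orP; right.
  move: xa; rewrite -ltNge; set r := alpha / beta => xr.
  have : r <= 1 - x.
    by rewrite ler_pdivrMr// mulrC ltW.
  nra.
split; last by [].
have b1 : 0 < 1 - beta by lra.
apply/orP; left; apply: mulr_ge0; first by lra.
by rewrite subr_ge0 ler_pdivrMr// mulrC; lra.
Qed.

(** Relaxing a constraint by 6 d moves its vertex by 6 d / beta or 6 d / (1 - beta), and the
    objective has slope at most 1 in absolute value. If the optimal vertex is 1 or 0, the bound
    [0 <= A <= 1] alone gives the estimate. *)
Lemma limit_height_upper (x y d A : R) :
  0 < alpha -> 0 <= beta <= 1 -> 0 <= x <= 1 -> 0 <= y <= 1 -> 0 < d ->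
  0 <= A <= 1 ->
  - (6%:R * d) <= alpha + beta * (x - A) ->
  - (6%:R * d) <= alpha + (1 - beta) * (A - x) ->
  y * A - (alpha + (1 - beta) * (A - x)) <= limit_height x y + limit_height_slack * d.
Proof.
move=> alpha_gt0 beta01 /andP[x_ge0 x_le1] /andP[y_ge0 y_le1].
have /andP[beta_ge0 beta_le1] := beta01.
move=> d_gt0 /andP[A0 A1] pA qA; have [C6 Cb Cb1] := limit_height_slack_ge beta01.
move: C6 Cb Cb1; set C := limit_height_slack => C6 Cb Cb1.
have Cd : 0 <= C * d by nra.
rewrite /limit_height; case: ifPn => yb; case: ifPn => xa.
- have : 0 <= (y - (1 - beta)) * (1 - A) by apply: mulr_ge0; lra.
  have : x + y - 1 <= Num.max 0 (x + y - 1) by rewrite le_max lexx orbT.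
  nra.
- have b0 := beta_gt0_of_zone alpha_gt0 beta_ge0 xa.
  set r := alpha / beta; have ar : alpha = beta * r by rewrite /r; field; rewrite gt_eqF.
  have : y * x - (1 - y) * r <= Num.max 0 (y * x - (1 - y) * r).
    by rewrite le_max lexx orbT.
  have Ar : A - x - r <= 6%:R / beta * d.
    by rewrite mulrAC ler_pdivlMr//; rewrite ar in pA; nra.
  have : (y - 1 + beta) * (A - x - r) <= C * d.
    apply: (@le_trans _ _ (6%:R / beta * d)); last by rewrite ler_wpM2r// ltW.
    have : 0 <= 6%:R / beta * d by rewrite !mulr_ge0 ?invr_ge0// ltW.
    nra.
  move: ar; clearbody r; lra.
- have : 0 <= Num.max 0 (x + y - 1) by rewrite le_max lexx.
  move: yb; rewrite -ltNge => yb.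
  have : 0 <= ((1 - beta) - y) * A by apply: mulr_ge0; lra.
  nra.
- move: yb; rewrite -ltNge => yb; have b1 : 0 < 1 - beta by lra.
  set r := alpha / (1 - beta); have ar : alpha = (1 - beta) * r by rewrite /r; field;
    rewrite gt_eqF.
  have : y * (x - r) <= Num.max (y * (x - r)) (x + y - 1) by rewrite le_max lexx.
  have Ar : - (6%:R / (1 - beta) * d) <= A - x + r.
    by rewrite lerNl mulrAC ler_pdivlMr//; rewrite {1}ar in qA; nra.
  have : (y - (1 - beta)) * (A - x + r) <= C * d.
    apply: (@le_trans _ _ (6%:R / (1 - beta) * d)); last by rewrite ler_wpM2r// ltW.
    have : 0 <= 6%:R / (1 - beta) * d by rewrite !mulr_ge0 ?invr_ge0// ltW.
    nra.
  move: ar; clearbody r; lra.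
Qed.

(** Unless a boundary term wins, the vertex is moved into the feasible interval by [eta], chosen so
    that its constraint gains a margin of 6 d. The slope of the objective is at most beta,
    respectively at least -(1 - beta), so this costs at most 6 d. *)
Lemma limit_height_lower (x y d : R) :
  0 < alpha -> 0 <= beta <= 1 -> 0 <= x <= 1 -> 0 <= y <= 1 -> 0 < d ->
  12%:R * d <= alpha ->
  [\/ limit_height x y = 0, limit_height x y = x + y - 1 |
    exists2 A : R, 0 <= A <= 1 &
     [/\ 6%:R * d <= alpha + beta * (x - A),
         6%:R * d <= alpha + (1 - beta) * (A - x) &
         limit_height x y - 6%:R * d <= y * A - (alpha + (1 - beta) * (A - x))]].
Proof.
move=> alpha_gt0 beta01 /andP[x_ge0 x_le1] /andP[y_ge0 y_le1].
have /andP[beta_ge0 beta_le1] := beta01.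
move=> d_gt0 da; rewrite /limit_height; case: ifPn => yb; case: ifPn => xa.
- by case: (leP 0 (x + y - 1)) => _; [exact: Or32|exact: Or31].
- have b0 := beta_gt0_of_zone alpha_gt0 beta_ge0 xa.
  set r := alpha / beta; have ar : alpha = beta * r by rewrite /r; field; rewrite gt_eqF.
  case: leP => _; last exact: Or31.
  move: xa; rewrite -ltNge => xa.
  have xr : x + r < 1 by rewrite ar -subr_gt0 in xa; nra.
  pose eta := 6%:R * d / beta; have etaE : beta * eta = 6%:R * d by rewrite /eta; field;
    rewrite gt_eqF.
  have eta0 : 0 < eta by rewrite divr_gt0// mulr_gt0.
  (* This is where 12 d <= alpha enters. It keeps the moved vertex to the right of x, where the
     other constraint has margin at least alpha. *)
  have re : 6%:R * d + eta <= r.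
    rewrite -(ler_pM2l b0) mulrDr etaE -ar; nra.
  apply: Or33; exists (x + r - eta); first by lra.
  by rewrite ar; split; nra.
- by case: (leP 0 (x + y - 1)) => _; [exact: Or32|exact: Or31].
- move: yb; rewrite -ltNge => yb; have b1 : 0 < 1 - beta by lra.
  set r := alpha / (1 - beta); have ar : alpha = (1 - beta) * r by rewrite /r; field;
    rewrite gt_eqF.
  case: leP => _; first exact: Or32.
  move: xa; rewrite -ltNge => xa.
  have xr : r < x by rewrite {1}ar -subr_gt0 in xa; nra.
  pose eta := 6%:R * d / (1 - beta).
  have etaE : (1 - beta) * eta = 6%:R * d by rewrite /eta; field; rewrite gt_eqF.
  have eta0 : 0 < eta by rewrite divr_gt0// mulr_gt0.
  have re : 6%:R * d + eta <= r.
    rewrite -(ler_pM2l b1) mulrDr etaE -ar; nra.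
  apply: Or33; exists (x - r + eta); first by lra.
  by rewrite ar; split; nra.
Qed.

End limit_height.

(** Passes from M + 1 positions to all of them, so that a union bound has a number of terms
    independent of n. *)
Lemma lipschitz_grid (R : realType) (n M : nat) (g : nat -> R) (d : R) :
  (0 < M)%N -> (forall i, (i < n)%N -> `|g i.+1 - g i| <= 1) ->
  (forall k, (k <= M)%N -> `|g (k * n %/ M)%N| <= d) ->
  forall a, (a <= n)%N -> `|g a| <= d + n%:R / M%:R + 1.
Proof.
move=> M0 g1 gM a an.
have MR : 0 < M%:R :> R by rewrite ltr0n.
have [n0|n0] := posnP n.
  have -> : a = (0 * n %/ M)%N by rewrite mul0n div0n; lia.
  apply: (le_trans (gM _ (leq0n _))); rewrite n0 mul0r; lra.
have lip b k : (b + k <= n)%N -> `|g (b + k)%N - g b| <= k%:R.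
  elim: k => [|k IH] bk; first by rewrite addn0 subrr normr0.
  have -> : g (b + k.+1)%N - g b = (g (b + k).+1 - g (b + k)%N) + (g (b + k)%N - g b).
    by rewrite addnS; ring.
  rewrite (le_trans (ler_normD _ _))// -natr1 addrC lerD//.
    by apply: IH; lia.
  by apply: g1; lia.
(* A grid position at or before a; the two roundings together lose less than n / M + 1. *)
pose k := (a * M %/ n)%N; pose b := (k * n %/ M)%N.
have kM : (k <= M)%N by rewrite -ltnS ltn_divLR// mulSn; nia.
have ba : (b <= a)%N.
  by rewrite -ltnS ltn_divLR// mulSn; have := leq_divM (a * M) n; rewrite -/k; lia.
have abn : (a * M < b * M + M + n)%N.
  have := ltn_ceil (a * M) n0; have := ltn_ceil (k * n) M0; rewrite -/k -/b !mulSn; lia.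
have {}abn : (a - b)%:R <= n%:R / M%:R + 1 :> R.
  have -> : n%:R / M%:R + 1 = (n + M)%:R / M%:R :> R.
    by rewrite natrD; field; rewrite gt_eqF.
  by rewrite ler_pdivlMr// -natrM ler_nat mulnBl; lia.
have := gM _ kM; have := lip b (a - b)%N; rewrite subnKC// => /(_ an).
rewrite -/b => gab gb.
have -> : g a = (g a - g b) + g b by ring.
by rewrite (le_trans (ler_normD _ _))//; lra.
Qed.

(** * Comparison with the limiting height for a fixed initial permutation *)

Section deterministic.
Variable R : realType.
Implicit Types alpha beta d x y : R.

(** After division by n, the conditions p >= 0 and q >= 0 and the cost q are those of the linear
    program up to multiples of d. The worst case is q in the lower bound: t, E(i), E(a) and the
    rounding of a contribute d each and the position i contributes 2 d, whence the margin 6 d. *)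
Lemma sweeps_close alpha beta d x y n (m t i : nat) (c : seq 'I_n.-1) (v : 'S_n) :
  0 < alpha -> 0 <= beta <= 1 -> 0 <= x <= 1 -> 0 <= y <= 1 -> 0 < d ->
  12%:R * d <= alpha -> (0 < n)%N -> (m <= n)%N -> (i <= n)%N ->
  coxeter_word c ->
  1 <= d * n%:R ->
  `|t%:R - alpha * n%:R| <= d * n%:R ->
  `|i%:R - x * n%:R| <= d * n%:R ->
  `|m%:R - y * n%:R| <= d * n%:R ->
  (forall a, (a <= n)%N ->
     `|(count_upto (before c) a)%:R - beta * a%:R| <= d * n%:R) ->
  (forall a, (a <= n)%N ->
     `|(height m v a)%:R - a%:R * (m%:R / n%:R)| <= d * n%:R) ->
  `|(height m (iter t (tau_word c) v) i)%:R / n%:R - limit_height alpha beta x y|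
    <= (limit_height_slack beta + 20%:R) * d.
Proof.
move=> alpha_gt0 beta01 x01 y01 d0 da n0 mn iN cox dn tE iE mE eE hE.
have nR : 0 < n%:R :> R by rewrite ltr0n.
have nR0 : n%:R != 0 :> R by rewrite gt_eqF.
have /andP[x0 x1] := x01; have /andP[y0 y1] := y01; have /andP[b0 b1] := beta01.
have [C6 _ _] := limit_height_slack_ge beta01.
have [H0 Hxy] := limit_height_ge alpha_gt0 beta01 x01 y01.
set C := limit_height_slack beta in C6 *; set H := limit_height _ _ _ _ in H0 Hxy *.
set h := height _ _ _.
have scale (k : nat) z : `|k%:R - z * n%:R| <= d * n%:R -> - d <= k%:R / n%:R - z <= d.
  move=> kz; rewrite -ler_norml -(ler_pM2r nR).
  by rewrite -[X in _ * X](gtr0_norm nR) -normrM mulrBl divfK.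
have {}dn : n%:R^-1 <= d by rewrite -[leLHS]mul1r ler_pdivrMr.
have {tE}/andP[tE tE'] := scale _ _ tE.
have {iE}/andP[iE iE'] := scale _ _ iE.
have {mE}/andP[mE mE'] := scale _ _ mE.
pose E a : R := (count_upto (before c) a)%:R / n%:R.
pose S a : R := (count_upto (fun j => ~~ before c j) a)%:R / n%:R.
pose A (a : nat) : R := a%:R / n%:R.
have ES a : S a = A a - E a.
  by rewrite /S /A /E -{2}(count_uptoC (before c) a) natrD; lra.
have {}eE a : (a <= n)%N -> - d <= E a - beta * A a <= d.
  by move=> an; apply: scale; rewrite /A mulrA divfK// eE.
have A01 a : (a <= n)%N -> 0 <= A a <= 1.
  by move=> an; rewrite /A divr_ge0//= ler_pdivrMr// mul1r ler_nat.
have {}hE a : (a <= n)%N ->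
    - (d + d) <= (height m v a)%:R / n%:R - y * A a <= d + d.
  move=> an; have /andP[] := A01 _ an.
  have := scale _ (A a * (m%:R / n%:R)) _; rewrite mulrAC divfK// => /(_ _ (hE _ an)).
  by move=> /andP[]; nra.
have hA a : (0 <= a%:R / n%:R :> R) by rewrite divr_ge0.
rewrite -/(A i) in iE iE'.
have bi : - d <= beta * (A i - x) <= d by nra.
have /andP[bi1 bi2] := bi.
have /andP[Ei1 Ei2] := eE _ iN.
rewrite ler_norml; apply/andP; split; last first.
  case: (sweeps_upper v cox mn t iN); rewrite -/h.
  - by move=> ->; rewrite mul0r; nra.
  - rewrite -(ler_nat R) !natrD -(ler_pM2r (x:=n%:R^-1)) ?invr_gt0// !mulrDl divff// -/(A
    i).
    by nra.
  - move=> [a [p [q [an pE qE hq]]]].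
    have /andP[Ea1 Ea2] := eE _ an; have /andP[ha1 ha2] := hE _ an.
    have {}pE : t%:R / n%:R + E i = p%:R / n%:R + E a.
      by rewrite /E -!mulrDl -!natrD pE.
    have {}qE : t%:R / n%:R + S a = q%:R / n%:R + S i.
      by rewrite /S -!mulrDl -!natrD qE.
    move: hq; rewrite -(ler_nat R) natrD -(ler_pM2r (x:=n%:R^-1)) ?invr_gt0// mulrDl => hq.
    have p0 := hA p; have q0 := hA q; rewrite !ES in qE.
    have := @limit_height_upper _ _ _ _ _ d (A a) alpha_gt0 beta01 x01 y01 d0 (A01 _ an).
    rewrite -/H -/C => /(_ _ _).
    have -> : - (6%:R * d) <= alpha + beta * (x - A a).
      lra.
    have -> : - (6%:R * d) <= alpha + (1 - beta) * (A a - x).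
      lra.
    move=> /(_ isT isT); lra.
case: (limit_height_lower alpha_gt0 beta01 x01 y01 d0 da); rewrite -/H.
- by move=> ->; have := hA h; nra.
- move=> ->; have := height_ge (iter t (tau_word c) v) mn iN.
  rewrite -/h.
  rewrite -(ler_nat R) !natrD -(ler_pM2r (x:=n%:R^-1)) ?invr_gt0// !mulrDl divff// -/(A i).
  nra.
move=> [A' A'01 [P Q V]].
pose a := Num.truncn (A' * n%:R).
have /andP[A'0 A'1] := A'01.
have A'n0 : 0 <= A' * n%:R by rewrite mulr_ge0.
have /andP[an1 an2] := truncn_itv A'n0; rewrite -/a in an1 an2.
have an : (a <= n)%N.
  by rewrite -(ler_nat R) (le_trans an1)// ler_piMl.
have aA2 : A a <= A' by rewrite /A ler_pdivrMr.
have aA1 : A' - d <= A a.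
  have : A' <= A a + n%:R^-1 by rewrite /A -[X in _ + X]mul1r -mulrDl natr1 ler_pdivlMr//
    ltW.
  lra.
have /andP[Ea1 Ea2] := eE _ an; have /andP[ha1 ha2] := hE _ an.
have /andP[Aa0 Aa1] := A01 _ an.
have ba : - d <= beta * (A a - A') <= 0 by nra.
have /andP[ba1 ba2] := ba.
(* The margins [P] and [Q] make both natural subtractions exact, although [a] is only a rounding of
   the point A'. *)
pose p := (t + count_upto (before c) i - count_upto (before c) a)%N.
pose q := (t + count_upto (fun j => ~~ before c j) a - count_upto (fun j => ~~ before c
  j) i)%N.
have pE : (t + count_upto (before c) i = p + count_upto (before c) a)%N.
  rewrite subnK// -(ler_nat R) natrD -(ler_pM2r (x:=n%:R^-1)) ?invr_gt0// mulrDl.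
  rewrite -/(E a) -/(E i); lra.
have qE : (t + count_upto (fun j => ~~ before c j) a = q + count_upto (fun j => ~~ before
  c j) i)%N.
  rewrite subnK// -(ler_nat R) natrD -(ler_pM2r (x:=n%:R^-1)) ?invr_gt0// mulrDl.
  rewrite -/(S a) -/(S i) !ES; lra.
have := sweeps_lower v cox mn iN an pE qE; rewrite -/h.
rewrite -(ler_nat R) natrD -(ler_pM2r (x:=n%:R^-1)) ?invr_gt0// mulrDl => hq.
have {}qE : t%:R / n%:R + S a = q%:R / n%:R + S i.
  by rewrite /S -!mulrDl -!natrD qE.
rewrite !ES in qE; have yA : y * (A' - A a) <= d.
  by rewrite (le_trans (ler_piMl _ y1))//; lra.
have Cd : 0 <= (C - 6%:R) * d by apply: mulr_ge0; [lra|exact: ltW].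
lra.
Qed.

End deterministic.

(** * Convergence of the heights in probability *)

Section uniform_pr.
Variables (R : realType) (T : finType).
Implicit Types A B : {set T}.

Lemma uniform_pr_ge0 A : 0 <= uniform_pr A :> R.
Proof. by rewrite divr_ge0. Qed.

Lemma uniform_pr_le A B : A \subset B -> uniform_pr A <= uniform_pr B :> R.
Proof. by move=> AB; rewrite ler_wpM2r ?invr_ge0// ler_nat subset_leq_card. Qed.

Lemma uniform_pr_bigcup (I : finType) (B : I -> {set T}) :
  uniform_pr (\bigcup_i B i)%SET <= \sum_i uniform_pr (B i) :> R.
Proof.
rewrite -mulr_suml ler_wpM2r ?invr_ge0// -natr_sum ler_nat.
elim/big_ind2 : _ => [|A a B' b Aa Bb|//]; first by rewrite cards0.
by rewrite cardsU (leq_trans (leq_subr _ _))// leq_add.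
Qed.

End uniform_pr.

(** Steps before b contribute fully to n theta(z), steps after b nothing; only step b can be
    traversed in part. *)
Lemma theta_count_upto (R : realType) n (c : seq 'I_n.-1) (z : R) (b : nat) :
  (b <= n)%N -> b%:R <= n%:R * z < b.+1%:R ->
  0 <= n%:R * theta (coxeter_path c) z - (count_upto (before c) b)%:R <= 1.
Proof.
move=> bn /andP[bz zb]; have [n0|n0] := posnP n.
  have -> : b = 0%N by lia.
  have nR : n%:R = 0 :> R by rewrite n0.
  by rewrite count_upto0 nR mul0r subr0 lexx ler01.
have nR : 0 < n%:R :> R by rewrite ltr0n.
rewrite /theta mulrCA divff ?gt_eqF// mulr1 [path_start _]/= mulr0z add0r.
have -> : (count_upto (before c) b)%:R =
    \sum_(j < n) (is_east (coxeter_path c) j && (j < b)%N)%:R :> R.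
  rewrite /count_upto big_mkord (big_ord_widen n (fun j => nat_of_bool (before c j)) bn)
    natr_sum big_mkcond /=.
  apply: eq_bigr => j _; rewrite beforeE; case: ltnP; rewrite ?andbT ?andbF//.
rewrite big_mkcond -sumrB.
pose clip (j : 'I_n) : R := Num.min 1 (Num.max 0 (n%:R * z - j%:R)).
pose F (j : 'I_n) : R := (if is_east (coxeter_path c) j then clip j else 0) -
  (is_east (coxeter_path c) j && (j < b)%N)%:R.
rewrite -[X in 0 <= X <= 1]/(\sum_j F j).
suff FE j : 0 <= F j <= (j == b :> nat)%:R.
  rewrite sumr_ge0/=; last by move=> j _; have /andP[] := FE j.
  apply: (@le_trans _ _ (\sum_(j < n) (j == b :> nat)%:R)).
    by apply: ler_sum => j _; have /andP[] := FE j.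
  rewrite -natr_sum (ler_nat _ _ 1) -big_mkcond/= sum1_card.
  apply/card_le1_eqP => i j /eqP ib /eqP jb; apply/val_inj.
  by rewrite /= ib jb.
rewrite /F /clip; case: is_east => /=; last by rewrite subrr lexx ler0n.
have [jb|bj|->] := ltngtP j b => /=.
- have : j.+1%:R <= b%:R :> R by rewrite ler_nat.
  rewrite -natr1 => jb'; rewrite (@max_idPr _ _ _ _ _) ?(@min_idPl _ _ _ _ _); lra.
- have : b.+1%:R <= j%:R :> R by rewrite ler_nat.
  move=> jb'; rewrite (@max_idPl _ _ _ _ _) ?(@min_idPr _ _ _ _ _); lra.
- rewrite subr0 le_min ler01 ge_min lexx andbT /= le_max lexx //.
Qed.

Section height_limit.
Variables (R : realType) (alpha beta : R) (c : forall n : nat, seq 'I_n.-1).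
Variables (x y : R) (im mm : nat -> nat).

Lemma height_in_probability :
  0 < alpha -> 0 <= beta <= 1 ->
  (forall n : nat, (1 <= n)%N -> coxeter_word (c n)) ->
  (forall z : R, 0 <= z <= 1 ->
     theta (coxeter_path (c n)) z @[n --> \oo] --> beta * z) ->
  0 <= x <= 1 -> 0 <= y <= 1 ->
  (forall n, (im n <= n)%N /\ `|(im n)%:R - x * n%:R| <= 1) ->
  (forall n, (mm n <= n)%N /\ `|(mm n)%:R - y * n%:R| <= 1) ->
  forall e : R, 0 < e ->
  uniform_pr [set v : 'S_n | (e <= `|
    (height (mm n) (iter (Num.truncn (alpha * n%:R)) (tau_word (c n)) v) (im n))%:R
      / n%:R - limit_height alpha beta x y|)%R]%SET
  @[n --> \oo] --> (0 : R).
Proof.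
move=> alpha_gt0 beta01 cox theta_cvg x01 y01 imE mmE e e0.
have /andP[b0 b1] := beta01.
have [C6 _ _] := limit_height_slack_ge beta01.
set C := limit_height_slack beta in C6.
(* The first bound is the hypothesis of [limit_height_lower]; the second puts the error of
   [sweeps_close] strictly below e. *)
pose d := Num.min (alpha / 12%:R) (e / (2%:R * (C + 20%:R))).
have C0 : 0 < 2%:R * (C + 20%:R) by lra.
have d0 : 0 < d by rewrite lt_min !divr_gt0.
have da : 12%:R * d <= alpha.
  by rewrite mulrC -ler_pdivlMr// ge_min lexx.
have de : (C + 20%:R) * d < e.
  have : d * (2%:R * (C + 20%:R)) <= e by rewrite -ler_pdivlMr// ge_min lexx orbT.
  lra.
pose M := (Num.truncn (3%:R / d)).+1.
have MR : 0 < M%:R :> R by rewrite ltr0n.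
have Md : M%:R^-1 <= d / 3%:R.
  rewrite invf_ple ?posrE// ?divr_gt0// invf_div.
  have /andP[_ /ltW] := truncn_itv (ltW (divr_gt0 (ltr0n R 3) d0)); exact.
(* The step counts are within 3 d' n at the grid positions; interpolation adds n / M <= 3 d' n and
   1, which stays within d n = 9 d' n once d' n >= 2. *)
pose d' := d / 9%:R; have d'0 : 0 < d' by rewrite divr_gt0.
have kM01 (k : 'I_M.+1) : 0 <= k%:R / M%:R :> R /\ k%:R / M%:R <= 1 :> R.
  by rewrite divr_ge0// ler_pdivrMr// mul1r ler_nat -ltnS ltn_ord.
have near_theta : \forall n \near \oo, forall k : 'I_M.+1,
    `|beta * (k%:R / M%:R) - theta (coxeter_path (c n)) (k%:R / M%:R)| <= d'.
  apply: filter_forall => k; have [k0 k1] := kM01 k.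
  have /cvgrPdist_le := theta_cvg (k%:R / M%:R) (introT andP (conj k0 k1)).
  exact.
pose pr (n : nat) : R := uniform_pr [set v : 'S_n | (e <= `|
    (height (mm n) (iter (Num.truncn (alpha * n%:R)) (tau_word (c n)) v) (im n))%:R
      / n%:R - limit_height alpha beta x y|)%R]%SET.
(* A sum of M + 1 Chebyshev bounds, of order 1/n because M and d' do not depend on n. *)
have bound : \forall n \near \oo, 0 <= pr n <=
  M.+1%:R * (d' ^+ 2)^-1 * n%:R^-1.
  near=> n.
  have dn : 2%:R <= d' * n%:R.
    by rewrite mulrC -ler_pdivrMr//; near: n; exact: nbhs_infty_ger.
  have th : forall k : 'I_M.+1,
    `|beta * (k%:R / M%:R) - theta (coxeter_path (c n)) (k%:R / M%:R)| <= d'.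
    by near: n; exact: near_theta.
  have n0 : (0 < n)%N.
    by rewrite lt0n; apply/eqP => n0; move: dn; rewrite n0 mulr0; lra.
  have nR : 0 < n%:R :> R by rewrite ltr0n.
  have d9 : d = 9%:R * d' by rewrite /d'; field.
  have [imn imx] := imE n; have [mmn mmy] := mmE n.
  have nM : n%:R / M%:R <= 3%:R * d' * n%:R.
    by rewrite mulrC ler_wpM2r ?ler0n// (le_trans Md)// [leLHS](_ : _ = 3%:R * d')// d9;
      field.
  rewrite /pr uniform_pr_ge0 /=.
  pose b (k : nat) := (k * n %/ M)%N.
  have bn (k : 'I_M.+1) : (b k <= n)%N.
    have kM : (k <= M)%N by rewrite -ltnS ltn_ord.
    apply: (@leq_trans (M * n %/ M)); last by rewrite mulKn.
    by apply: leq_div2r; rewrite leq_mul2r kM orbT.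
  have bkE (k : nat) (z : R) : z = n%:R * (k%:R / M%:R) -> (b k)%:R <= z < (b k).+1%:R.
    move=> ->.
    have -> : n%:R * (k%:R / M%:R) = (k * n)%:R / M%:R :> R.
      by rewrite natrM mulrA [k%:R * n%:R]mulrC.
    apply/andP; split; first by rewrite ler_pdivlMr// -natrM ler_nat leq_divM.
    by rewrite ltr_pdivrMr// -natrM ltr_nat ltn_ceil.
  have Eb a : (a <= n)%N ->
      `|(count_upto (before (c n)) a)%:R - beta * a%:R| <= d * n%:R.
    pose g a : R := (count_upto (before (c n)) a)%:R - beta * a%:R.
    move=> an; rewrite -/(g a).
    apply: (le_trans (@lipschitz_grid R n M g (3%:R * d' * n%:R) _ _ _ a an)) => //.
    + move=> j jn; rewrite /g count_uptoS natrD -natr1 mulrDr mulr1.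
      rewrite (_ : _ - _ = (before (c n) j)%:R - beta); last by ring.
      by rewrite ler_norml; case: (before _ _) => /=; lra.
    + move=> k kM; have kM' : (k < M.+1)%N by [].
      have := th (Ordinal kM'); have := bkE k _ erefl; have := bn (Ordinal kM');
        rewrite /= => bkn kE.
      have := theta_count_upto (c n) bkn kE.
      move: kE => /andP[]; rewrite -natr1.
      set t := theta _ _; set z := k%:R / M%:R => kE1 kE2 /andP[t1 t2].
      rewrite ler_norml => /andP[t3 t4].
      rewrite -/(b k) /g; set B := (b k)%:R in kE1 kE2 *; set G := _%:R in t1 t2 *.
      have : - (d' * n%:R) <= n%:R * (beta * z - t) <= d' * n%:R by nra.
      have : 0 <= beta * (n%:R * z - B) <= 1 by nra.
      by move=> /andP[? ?] /andP[? ?]; rewrite ler_norml; lra.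
    + by rewrite d9; lra.
  pose B (k : 'I_M.+1) := [set v : 'S_n |
    (d' * n%:R <= `|(height (mm n) v (b k))%:R - (b k)%:R * ((mm n)%:R / n%:R)|)%R]%SET.
  apply: (@le_trans _ _ (uniform_pr (\bigcup_k B k)%SET)).
    apply: uniform_pr_le; apply/fintype.subsetP => v; rewrite inE => ev.
    apply: contraTT ev => vB; rewrite -ltNge; apply: le_lt_trans de.
    have hB (k : 'I_M.+1) :
        `|(height (mm n) v (b k))%:R - (b k)%:R * ((mm n)%:R / n%:R)| <= d' * n%:R.
      apply/ltW; rewrite ltNge; apply: contraNN vB => vB.
      by apply/finset.bigcupP; exists k => //; rewrite inE.
    apply: sweeps_close => //.
    + exact: cox.
    + by rewrite d9; lra.
    + have an0 : 0 <= alpha * n%:R by rewrite mulr_ge0// ltW.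
      have /andP[] := truncn_itv an0; rewrite -natr1 => t1 t2.
      by rewrite ler_norml d9; lra.
    + by apply: (le_trans imx); rewrite d9; lra.
    + by apply: (le_trans mmy); rewrite d9; lra.
    + move=> a an; pose g a : R := (height (mm n) v a)%:R - a%:R * ((mm n)%:R / n%:R).
      have s01 : 0 <= ((mm n)%:R / n%:R : R) <= 1.
        by rewrite divr_ge0// ler_pdivrMr// mul1r ler_nat.
      rewrite -/(g a).
      apply: (le_trans (@lipschitz_grid R n M g (d' * n%:R) _ _ _ a an)) => //.
      * move=> j jn; rewrite /g (heightS _ v (Ordinal jn)) natrD -natr1 mulrDl mul1r.
        rewrite (_ : _ - _ = (v (Ordinal jn) < mm n)%N%:R - (mm n)%:R / n%:R); last by ring.
        by move: s01 => /andP[? ?]; rewrite ler_norml; case: (_ < _)%N => /=; lra.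
      * by move=> k kM; exact: (hB (@Ordinal M.+1 k kM)).
      * by rewrite d9; lra.
  apply: le_trans (uniform_pr_bigcup _ _) _.
  apply: (@le_trans _ _ (\sum_(k < M.+1) (d' ^+ 2 * n%:R)^-1)).
    by apply: ler_sum => k _; apply: height_deviation.
  by rewrite sumr_const card_ord -[leRHS]mulrA -invfM mulr_natl.
apply: (squeeze_cvgr bound); first exact: cvg_cst.
rewrite -[X in _ --> X](mulr0 (M.+1%:R * (d' ^+ 2)^-1)).
apply: cvgM; first exact: cvg_cst.
apply/cvgrPdist_le => r r0; near=> n.
rewrite sub0r normrN normfV ger0_norm//.
have rn : r^-1 <= n%:R by near: n; exact: nbhs_infty_ger.
by rewrite -[r]invrK lef_pV2// posrE ?invr_gt0//; apply: lt_le_trans rn; rewrite invr_gt0.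
Unshelve. all: by end_near.
Qed.

End height_limit.

(** * The height function of [nu] *)

Section quotients.
Variables (R : realType) (alpha beta : R).
Hypotheses (alpha_gt0 : 0 < alpha) (beta01 : 0 <= beta <= 1).

Lemma diveE (a : R) : 0 < alpha -> 0 <= a ->
  (alpha%:E / a%:E)%E = if a == 0 then +oo%E else (alpha / a)%:E.
Proof.
move=> a0 age0; case: eqVneq => [->|an0]; last by rewrite inver (negbTE an0) EFinM.
by rewrite inve0 gt0_muley// lte_fin.
Qed.

Let b0 : 0 <= beta. Proof. by case/andP: beta01. Qed.
Let b1 : 0 <= 1 - beta. Proof. by rewrite subr_ge0; case/andP: beta01. Qed.

(** Clearing the denominator turns the conditions with alpha / 0 = +oo into polynomial inequalities,
    uniform in beta including 0 and 1. *)
Let quoE (a x : R) : 0 <= a ->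
  (((alpha%:E / a%:E) <= x%:E)%E = (alpha <= a * x)) *
  ((x%:E <= (alpha%:E / a%:E))%E = (a * x <= alpha)).
Proof.
move=> a0; rewrite diveE//; case: eqVneq => [->|an0].
  by rewrite mul0r leey leye_eq (ltW alpha_gt0) leNgt alpha_gt0.
have {}a0 : 0 < a by rewrite lt_neqAle eq_sym an0.
by rewrite !lee_fin ler_pdivrMr// ler_pdivlMr// [x * a]mulrC.
Qed.

Lemma quo1_le x : (quo1 alpha beta <= x%:E)%E = (alpha <= (1 - beta) * x).
Proof. by rewrite quoE. Qed.

Lemma le_quo1 x : (x%:E <= quo1 alpha beta)%E = ((1 - beta) * x <= alpha).
Proof. by rewrite quoE. Qed.

Lemma quo0_le x : (quo0 alpha beta <= x%:E)%E = (alpha <= beta * x).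
Proof. by rewrite quoE. Qed.

Lemma le_quo0 x : (x%:E <= quo0 alpha beta)%E = (beta * x <= alpha).
Proof. by rewrite quoE. Qed.

Let sub1e (q : \bar R) x : (q != -oo)%E ->
  (((1 - q) <= x%:E)%E = ((1 - x)%:E <= q)%E) *
  ((x%:E <= (1 - q))%E = (q <= (1 - x)%:E)%E).
Proof.
by case: q => [q| |] //= _; rewrite -?EFinB ?lee_fin ?leNye ?leey ?leye_eq ?leeNy_eq;
  split => //; apply/idP/idP; lra.
Qed.

Let quo_ninfty (a : R) : 0 <= a -> ((alpha%:E / a%:E) != -oo)%E.
Proof. by move=> a0; rewrite diveE//; case: ifP. Qed.

Lemma sub_quo0_le x : (1 - quo0 alpha beta <= x%:E)%E = (beta * (1 - x) <= alpha).
Proof. by rewrite sub1e ?quo_ninfty// le_quo0. Qed.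

Lemma le_sub_quo0 x : (x%:E <= 1 - quo0 alpha beta)%E = (alpha <= beta * (1 - x)).
Proof. by rewrite sub1e ?quo_ninfty// quo0_le. Qed.

Lemma le_sub_quo1 x : (x%:E <= 1 - quo1 alpha beta)%E = (alpha <= (1 - beta) * (1 - x)).
Proof. by rewrite sub1e ?quo_ninfty// quo1_le. Qed.

Lemma dom_seE x : dom_se alpha beta x <->
  [/\ alpha <= (1 - beta) * x, beta * (1 - x) <= alpha & x <= 1].
Proof.
rewrite /dom_se /= ge_max quo1_le sub_quo0_le.
by split=> [[/andP[? ?] ?]|[? ? ?]]; split => //; apply/andP.
Qed.

Lemma dom_nwE x : dom_nw alpha beta x <->
  [/\ 0 <= x, (1 - beta) * x <= alpha & alpha <= beta * (1 - x)].
Proof.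
rewrite /dom_nw /= le_min le_quo1 le_sub_quo0.
by split=> [[? /andP[? ?]]|[? ? ?]]; split => //; apply/andP.
Qed.

Lemma dom_diagE x : dom_diag alpha beta x <->
  [/\ 0 <= x <= 1, beta * (1 - x) <= alpha & (1 - beta) * x <= alpha].
Proof.
rewrite /dom_diag /= sub_quo0_le le_quo1.
by split=> [[? /andP[? ?]]|[? ? ?]]; split => //; apply/andP.
Qed.

Lemma region_seE (x y : R) : region_se alpha beta (x, y) <->
  [/\ alpha <= (1 - beta) * x, x <= 1, 0 <= y &
    [/\ y <= 1 - beta, alpha <= (1 - beta) * (1 - y) & y <= curve_se alpha beta x]].
Proof.
rewrite /region_se /= le_min lee_fin quo1_le le_sub_quo1.
by split=> [[? ? ? /andP[? ?] ?]|[? ? ? [? ? ?]]]; split => //; apply/andP.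
Qed.

Lemma region_nwE (x y : R) : region_nw alpha beta (x, y) <->
  [/\ 0 <= x, alpha <= beta * (1 - x), 1 - beta <= y &
    [/\ alpha <= beta * y, y <= 1 & curve_nw alpha beta x <= y]].
Proof.
rewrite /region_nw /= ge_max lee_fin quo0_le le_sub_quo0.
by split=> [[? ? /andP[? ?] ? ?]|[? ? ? [? ? ?]]]; split => //; apply/andP.
Qed.

End quotients.

(** * Conditional distributions of [nu] on vertical lines *)

Section slices.
Variables (R : realType) (alpha beta : R).
Notation lambda := (@lebesgue_measure R).

(* The mass below height [y] of the conditional distribution of [nu] on the
   vertical line through [x], away from the endpoints of the curves. *)
Definition slice (x y : R) : R :=
  if alpha < (1 - beta) * x then
    if alpha < beta * (1 - x) then Num.min y 1
    else if curve_se alpha beta x < y then 1 else y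
  else
    if alpha < beta * (1 - x) then
      if curve_nw alpha beta x < y then Num.min y 1 else 0
    else if 1 - x < y then 1 else 0.

Definition nu_section (x y : R) : set R :=
  [set z | (0 <= z < y) /\ (region_se alpha beta (x, z) \/ region_nw alpha beta (x, z))].

Let lambda_cap (a b y : R) : 0 <= a -> a <= b ->
  lambda [set z | 0 <= z < y /\ a <= z <= b] =
    (if b < y then b - a else if a < y then y - a else 0)%:E.
Proof.
move=> a0 ab; case: ltP => yb; last case: ltP => ya.
- rewrite (_ : [set z | _] = `[a, b]%classic).
    rewrite lebesgue_measure_itv /= lte_fin; case: ltP => // ba.
    by rewrite (_ : b = a) ?subrr//; apply/le_anti/andP.
  by apply/seteqP; split=> z /=; rewrite in_itv /=; [case|move=> /andP[? ?]; split; lra].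
- rewrite (_ : [set z | _] = `[a, y[%classic).
    by rewrite lebesgue_measure_itv /= lte_fin ya.
  apply/seteqP; split=> z /=; rewrite in_itv /=; first by case=> /andP[? ?] /andP[? ?]; lra.
  by move=> /andP[? ?]; split; lra.
- rewrite (_ : [set z | _] = set0) ?measure0// -subset0 => z /= [/andP[? ?] /andP[? ?]];
  lra.
Qed.

Lemma curve_seE x : 0 < alpha -> 0 <= beta <= 1 -> x <= 1 ->
  [/\ 0 <= curve_se alpha beta x, curve_se alpha beta x < 1 &
   (1 - curve_se alpha beta x) * ((1 - beta) * (1 - x) + alpha) = alpha].
Proof.
move=> a0 b01 x1; have D0 := denom_se_gt0 a0 b01 x1; have /andP[b0 b1] := b01.
rewrite /curve_se subKr mulrAC -mulrA divff ?gt_eqF// mulr1.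
rewrite subr_ge0 ler_pdivrMr// mul1r lerDr; split => //.
  by apply: mulr_ge0; rewrite subr_ge0.
by rewrite gtrBl divr_gt0.
Qed.

Lemma curve_nwE x : 0 < alpha -> 0 <= beta <= 1 -> 0 <= x ->
  [/\ 0 < curve_nw alpha beta x, curve_nw alpha beta x <= 1 &
   curve_nw alpha beta x * (beta * x + alpha) = alpha].
Proof.
move=> a0 b01 x0; have D0 := denom_nw_gt0 a0 b01 x0; have /andP[b0 b1] := b01.
rewrite /curve_nw divfK ?gt_eqF//; split => //; first by rewrite divr_gt0.
by rewrite ler_pdivrMr// mul1r lerDr mulr_ge0.
Qed.

(** Comparing alpha with (1 - beta) x and beta (1 - x) gives four zones. If both products exceed
    alpha, the two regions meet at height 1 - beta and fill the line; if one does, a region fills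
    one side of its curve and the curve carries an atom; if neither does, the diagonal carries the
    unit mass. Equality is excluded because the closed domains of the curves and of the segment
    overlap there. *)
Lemma slice_sum (x y : R) : 0 < alpha -> 0 <= beta <= 1 -> 0 < x < 1 -> 0 <= y ->
  (1 - beta) * x != alpha -> beta * (1 - x) != alpha ->
  (lambda (nu_section x y) +
   (if `[<dom_se alpha beta x /\ (curve_se alpha beta x < y)%R>]
    then (1 - curve_se alpha beta x)%:E else 0) +
   (if `[<dom_nw alpha beta x /\ (curve_nw alpha beta x < y)%R>]
    then (curve_nw alpha beta x)%:E else 0) +
   (if `[<dom_diag alpha beta x /\ (1 - x < y)%R>] then 1 else 0) = (slice x y)%:E)%E.
Proof.
move=> a0 b01 /andP[x0 x1] y0 xs xn; have /andP[b0 b1] := b01.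
have [cs0 cs1 csE] := curve_seE a0 b01 (ltW x1).
have [cn0 cn1 cnE] := curve_nwE a0 b01 (ltW x0).
set cs := curve_se _ _ _ in cs0 cs1 csE *.
set cn := curve_nw _ _ _ in cn0 cn1 cnE *.
have D0 := denom_se_gt0 a0 b01 (ltW x1); have D0' := denom_nw_gt0 a0 b01 (ltW x0).
have -> : `[<dom_se alpha beta x /\ cs < y>] =
    [&& alpha < (1 - beta) * x, beta * (1 - x) < alpha & cs < y].
  rewrite [alpha < _]lt_neqAle eq_sym xs [_ < alpha]lt_neqAle xn /=.
  apply/asboolP/and3P => [[/dom_seE[]//]|[? ? ?]]; split => //.
  by apply/dom_seE => //; split => //; exact: ltW.
have -> : `[<dom_nw alpha beta x /\ cn < y>] =
    [&& (1 - beta) * x < alpha, alpha < beta * (1 - x) & cn < y].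
  rewrite [alpha < _]lt_neqAle [alpha == _]eq_sym xn [_ < alpha]lt_neqAle xs /=.
  apply/asboolP/and3P => [[/dom_nwE[]//]|[? ? ?]]; split => //.
  by apply/dom_nwE => //; split => //; exact: ltW.
have -> : `[<dom_diag alpha beta x /\ 1 - x < y>] =
    [&& beta * (1 - x) < alpha, (1 - beta) * x < alpha & 1 - x < y].
  rewrite [_ < alpha]lt_neqAle xn [X in [&& _, X & _]]lt_neqAle xs /=.
  apply/asboolP/and3P => [[/dom_diagE[]//]|[? ? ?]]; split => //.
  by apply/dom_diagE => //; split => //; rewrite !ltW.
rewrite /slice.
case: (ltgtP alpha ((1 - beta) * x)) xs => // hs _;
  case: (ltgtP alpha (beta * (1 - x))) xn => // hn _ /=; rewrite ?adde0 ?add0e.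
- have bp : 0 < beta by rewrite -(pmulr_lgt0 _ (_ : 0 < 1 - x)) ?subr_gt0//; lra.
  have bp' : 0 < 1 - beta by rewrite -(pmulr_lgt0 _ x0); lra.
  (* The two zone conditions weighted by beta and 1 - beta. It makes the bounds 1 - alpha / (1 -
     beta) and alpha / beta in the definitions of the regions inactive. *)
  have key : alpha < beta * (1 - beta) by nra.
  have csb : 1 - beta <= cs.
    have : (1 - cs) * ((1 - beta) * (1 - x) + alpha) <= beta * ((1 - beta) * (1 - x) +
      alpha) by rewrite csE; nra.
    by rewrite ler_pM2r//; lra.
  have cnb : cn <= 1 - beta.
    by rewrite -(ler_pM2r D0') cnE; nra.
  have -> : nu_section x y = [set z | 0 <= z < y /\ 0 <= z <= 1].
    apply/seteqP; split=> z /= [/andP[z0 zy]].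
      rewrite z0 zy; case=> [/region_seE|/region_nwE]; first by case=> // _ _ _ [? ? ?];
        split => //; lra.
      by case=> // _ _ _ [_ ->].
    move=> /andP[_ z1]; split; first by rewrite z0.
    case: (leP z (1 - beta)) => zb; [left; apply/region_seE => //|right;
      apply/region_nwE => //].
      have : 0 <= (1 - beta) * ((1 - beta) - z) by apply: mulr_ge0; lra.
      by rewrite -/cs; split; [lra|lra|lra|split; lra].
    have : 0 <= beta * (z - (1 - beta)) by apply: mulr_ge0; lra.
    by rewrite -/cn; split; [lra|lra|lra|split; lra].
  rewrite lambda_cap// minC; case: ltP => y1; first by rewrite subr0.
  by rewrite subr0; case: ltP => // y0'; rewrite (_ : y = 0)//; apply/le_anti/andP.
- have csb : cs <= 1 - beta.
    have : beta * ((1 - beta) * (1 - x) + alpha) <= (1 - cs) * ((1 - beta) * (1 - x) +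
      alpha) by rewrite csE; nra.
    by rewrite ler_pM2r//; lra.
  have csa : alpha <= (1 - beta) * (1 - cs).
    by rewrite -(ler_pM2r D0) -mulrA csE; nra.
  have -> : nu_section x y = [set z | 0 <= z < y /\ 0 <= z <= cs].
    apply/seteqP; split=> z /= [/andP[z0 zy]].
      rewrite z0 zy; case=> [/region_seE|/region_nwE]; first by case=> // _ _ _ [? ? ?];
        split.
      by case=> //; lra.
    move=> /andP[_ z1]; split; first by rewrite z0.
    left; apply/region_seE => //.
    have : 0 <= (1 - beta) * (cs - z) by apply: mulr_ge0; lra.
    by rewrite -/cs; split; [lra|lra|lra|split; lra].
  rewrite lambda_cap//; case: ltP => y1; first by rewrite subr0 -EFinD addrC subrK.
  by rewrite subr0 adde0; case: ltP => // y0'; rewrite (_ : y = 0)//; apply/le_anti/andP.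
- have cnb : 1 - beta <= cn.
    by rewrite -(ler_pM2r D0') cnE; nra.
  have cna : alpha <= beta * cn.
    by rewrite -(ler_pM2r D0') -mulrA cnE; nra.
  have -> : nu_section x y = [set z | 0 <= z < y /\ cn <= z <= 1].
    apply/seteqP; split=> z /= [/andP[z0 zy]].
      rewrite z0 zy; case=> [/region_seE|/region_nwE]; first by case=> //; lra.
      by case=> // _ _ _ [_ -> ->].
    move=> /andP[zc z1]; split; first by rewrite z0.
    right; apply/region_nwE => //.
    have : 0 <= beta * (z - cn) by apply: mulr_ge0; lra.
    by rewrite -/cn; split; [lra|lra|lra|split; lra].
  rewrite lambda_cap//; last exact: ltW.
  case: ltP => y1.
    by rewrite (le_lt_trans cn1 y1) -EFinD subrK.
  by rewrite -/cn; case: ifP => cny; rewrite ?adde0// -EFinD subrK.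
- have -> : nu_section x y = set0.
    rewrite -subset0 => z [_ [/region_seE|/region_nwE]]; first by case=> //; lra.
    by case=> //; lra.
  by rewrite measure0 add0e; case: ifP.
Qed.

End slices.

Section slice_slopes.
Variables (R : realType) (alpha beta : R).

(** The right-hand side is the slope in x of the corresponding branch of [limit_height];
    [slice_south] does the same below 1 - beta. *)
Lemma slice_north (x y : R) : 0 < alpha -> 0 <= beta <= 1 -> 0 < x < 1 ->
  1 - beta <= y <= 1 -> (1 - beta) * x != alpha -> beta * (1 - x) != alpha ->
  slice alpha beta x y =
    if beta * (1 - x) <= alpha then (if 0 < x + y - 1 then 1 else 0)
    else if 0 < y * x - (1 - y) * (alpha / beta) then y else 0.
Proof.
move=> a0 b01 /andP[x0 x1] /andP[by' y1] xs xn; have /andP[b0 b1] := b01.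
have [cs0 cs1 csE] := curve_seE a0 b01 (ltW x1).
have [cn0 cn1 cnE] := curve_nwE a0 b01 (ltW x0).
have D0 := denom_se_gt0 a0 b01 (ltW x1); have D0' := denom_nw_gt0 a0 b01 (ltW x0).
rewrite /slice; set cs := curve_se _ _ _ in cs0 cs1 csE *.
set cn := curve_nw _ _ _ in cn0 cn1 cnE *.
rewrite (min_l y1).
case: (ltgtP alpha (beta * (1 - x))) xn => // hn _; last first.
  case: (ltgtP alpha ((1 - beta) * x)) xs => // hs _; last first.
    by congr (if _ then _ else _); apply/idP/idP; lra.
  have csb : cs < 1 - beta.
    have : beta * ((1 - beta) * (1 - x) + alpha) < (1 - cs) * ((1 - beta) * (1 - x) +
      alpha) by rewrite csE; nra.
    by rewrite ltr_pM2r//; lra.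
  have csx : 1 - x <= cs.
    have : (1 - cs) * ((1 - beta) * (1 - x) + alpha) <= x * ((1 - beta) * (1 - x) +
      alpha) by rewrite csE; nra.
    by rewrite ler_pM2r//; lra.
  by rewrite (lt_le_trans csb by') ifT//; lra.
have bp : 0 < beta by rewrite -(pmulr_lgt0 _ (_ : 0 < 1 - x)) ?subr_gt0//; lra.
(* The north-west curve is the zero set of the second term of the maximum. *)
have eqv : (0 < y * x - (1 - y) * (alpha / beta)) = (cn < y).
  rewrite -(pmulr_rgt0 _ bp) -[RHS](ltr_pM2r D0') cnE.
  have -> : beta * (y * x - (1 - y) * (alpha / beta)) = y * (beta * x + alpha) - alpha.
    by field; rewrite gt_eqF.
  by rewrite subr_gt0.
rewrite eqv; case: (ltgtP alpha ((1 - beta) * x)) xs => // hs _.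
have cnb : cn < 1 - beta by rewrite -(ltr_pM2r D0') cnE; nra.
by rewrite (lt_le_trans cnb by').
Qed.

Lemma slice_south (x y : R) : 0 < alpha -> 0 <= beta <= 1 -> 0 < x < 1 ->
  0 <= y < 1 - beta -> (1 - beta) * x != alpha -> beta * (1 - x) != alpha ->
  slice alpha beta x y =
    if (1 - beta) * x <= alpha then (if 0 < x + y - 1 then 1 else 0)
    else if y * (x - alpha / (1 - beta)) < x + y - 1 then 1 else y.
Proof.
move=> a0 b01 /andP[x0 x1] /andP[y0 yb] xs xn; have /andP[b0 b1] := b01.
have [cs0 cs1 csE] := curve_seE a0 b01 (ltW x1).
have [cn0 cn1 cnE] := curve_nwE a0 b01 (ltW x0).
have D0 := denom_se_gt0 a0 b01 (ltW x1); have D0' := denom_nw_gt0 a0 b01 (ltW x0).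
rewrite /slice; set cs := curve_se _ _ _ in cs0 cs1 csE *.
set cn := curve_nw _ _ _ in cn0 cn1 cnE *.
have bp : 0 < 1 - beta by lra.
rewrite min_l; last by lra.
case: (ltgtP alpha ((1 - beta) * x)) xs => // hs _; last first.
  case: (ltgtP alpha (beta * (1 - x))) xn => // hn _; last first.
    by congr (if _ then _ else _); apply/idP/idP; lra.
  have cnb : 1 - beta <= cn by rewrite -(ler_pM2r D0') cnE; nra.
  have cnx : cn <= 1 - x by rewrite -(ler_pM2r D0') cnE; nra.
  by rewrite ltNge (ltW (lt_le_trans yb cnb)) /= ifF//; apply/negbTE; rewrite -leNgt; lra.
(* The south-east curve is where the two terms of the maximum coincide. *)
have eqv : (y * (x - alpha / (1 - beta)) < x + y - 1) = (cs < y).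
  rewrite -subr_gt0 -(pmulr_rgt0 _ bp) -[RHS](ltr_pM2r D0).
  have -> : (1 - beta) * (x + y - 1 - y * (x - alpha / (1 - beta))) =
      y * ((1 - beta) * (1 - x) + alpha) - (1 - beta) * (1 - x).
    by field; rewrite gt_eqF.
  by rewrite subr_gt0; congr (_ < _); lra.
rewrite eqv; case: (ltgtP alpha (beta * (1 - x))) xn => // hn _.
have csb : 1 - beta <= cs.
  have : (1 - cs) * ((1 - beta) * (1 - x) + alpha) <= beta * ((1 - beta) * (1 - x) +
    alpha) by rewrite csE; nra.
  by rewrite ler_pM2r//; lra.
by rewrite ltNge (ltW (lt_le_trans yb csb)).
Qed.

Lemma slice_min1 (x y : R) : 0 < alpha -> 0 <= beta <= 1 -> 0 < x < 1 ->
  slice alpha beta x y = slice alpha beta x (Num.min y 1).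
Proof.
move=> a0 b01 /andP[x0 x1]; case: (leP y 1) => // y1; have /andP[b0 b1] := b01.
have [cs0 cs1 csE] := curve_seE a0 b01 (ltW x1).
have [cn0 cn1 cnE] := curve_nwE a0 b01 (ltW x0).
have D0' := denom_nw_gt0 a0 b01 (ltW x0).
rewrite /slice (min_r (ltW y1)) minxx cs1 (lt_trans cs1 y1).
have -> : 1 - x < y by lra.
have -> : 1 - x < 1 by lra.
case: ifP => // _; case: ifP => // hn; rewrite (le_lt_trans cn1 y1).
have bp : 0 < beta by rewrite -(pmulr_lgt0 _ (_ : 0 < 1 - x)) ?subr_gt0//; lra.
have -> // : curve_nw alpha beta x < 1.
rewrite -(ltr_pM2r D0') cnE mul1r ltrDr; exact: mulr_gt0.
Qed.

End slice_slopes.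

Section slope_integral.
Variable R : realType.
Notation lambda := (@lebesgue_measure R).

(** The integrand is the slope of the larger of two affine functions, so its integral is the
    increment of their maximum. Equal slopes are treated apart, having no crossing point. *)
Lemma integral_max_slope (p q u1 u2 c1 c2 : R) : p <= q -> 0 <= c1 <= c2 ->
  (\int[lambda]_(x in `[p, q[) (if (u1 + c1 * x < u2 + c2 * x)%R then c2 else c1)%:E)%E =
  (Num.max (u1 + c1 * q) (u2 + c2 * q) - Num.max (u1 + c1 * p) (u2 + c2 * p))%:E.
Proof.
move=> pq /andP[c10]; rewrite le_eqVlt => /predU1P[<-|c12].
  under eq_integral do rewrite if_same.
  rewrite integral_cst//= lebesgue_measure_itv /= lte_fin.
  have -> : (if p < q then (q%:E - p%:E)%E else 0%E) = (q - p)%:E.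
    by case: ltP => // qp; rewrite (_ : q = p) ?subrr//; apply/le_anti/andP.
  by rewrite -EFinM; congr (_%:E); case: leP => h1; case: leP => h2; lra.
pose r := (u1 - u2) / (c2 - c1).
have c0 : 0 < c2 - c1 by lra.
have rE : u1 - u2 = r * (c2 - c1) by rewrite /r divfK// gt_eqF.
have cond x : (u1 + c1 * x < u2 + c2 * x) = (r < x).
  by rewrite -[RHS](ltr_pM2r c0) -rE; apply/idP/idP; lra.
transitivity (\int[lambda]_(x in `[p, q[) (c1%:E + (c2 - c1)%:E * (\1_(`]r, +oo[) x)%:E))%E.
  apply: eq_integral => x _; rewrite cond indicE mem_setE in_itv /= andbT.
  by case: (r < x); rewrite ?mule1 ?mule0 ?adde0 -?EFinD// addrC subrK.
rewrite ge0_integralD//=; last first.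
  - by apply: measurable_funeM; apply/measurable_EFinP; exact: measurable_indic.
  - by move=> x _; rewrite mule_ge0// lee_fin ltW.
rewrite integral_cst//= ge0_integralZl//=; last first.
  - by rewrite lee_fin ltW.
  - by apply/measurable_EFinP; exact: measurable_indic.
rewrite integral_indic//= lebesgue_measure_itv /= lte_fin.
have -> : (if p < q then (q%:E - p%:E)%E else 0%E) = (q - p)%:E.
  by case: ltP => // qp; rewrite (_ : q = p) ?subrr//; apply/le_anti/andP.
have -> : lambda (`]r, +oo[ `&` `[p, q[) = (Num.max 0 (q - Num.max p r))%:E.
  have [rp|pr] := ltP r p.
    rewrite (_ : _ `&` _ = `[p, q[%classic); last first.
      by apply/seteqP; split=> x /=; rewrite !in_itv /= andbT; [case|move=> /andP[? ?];
        split; lra].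
    rewrite lebesgue_measure_itv /= lte_fin max_r; last lra.
    by case: ltP => // qp; rewrite (_ : q = p) ?subrr//; apply/le_anti/andP.
  rewrite (_ : _ `&` _ = `]r, q[%classic); last first.
    by apply/seteqP; split=> x /=; rewrite !in_itv /= andbT; [case=> ? /andP[? ?];
      lra|move=> /andP[? ?]; split; lra].
  rewrite lebesgue_measure_itv /= lte_fin; case: ltP => rq.
    by rewrite max_r//; lra.
  by rewrite max_l//; lra.
rewrite -!EFinM -EFinD; congr (_%:E).
(* The steeper line wins to the right of [r]; to the left its deficit grows linearly in r - x. *)
have maxE x : Num.max (u1 + c1 * x) (u2 + c2 * x) = u2 + c2 * x + (c2 - c1) * Num.max 0
  (r - x).
  by case: (leP 0 (r - x)) => rx; case: leP => h; nra.
rewrite !maxE.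
case: (leP p r) => h1; case: (leP 0 (r - p)) => h2; case: (leP 0 (r - q)) => h3;
  case: leP => h4; nra.
Qed.

End slope_integral.

Section nu_rect.
Variables (R : realType).
Notation lambda := (@lebesgue_measure R).
Notation plane := (measurableTypeR R * measurableTypeR R)%type.

(** Half-open, so that differences of rectangles tile the square and a point of a curve counts
    exactly when its height is strictly below y. *)
Definition rect (x y : R) : set (R * R) := `[0, x[ `*` `[0, y[.

Lemma measurable_rect x y : measurable (rect x y : set plane).
Proof. by apply: measurableX; exact: measurable_itv. Qed.

(** All four terms of [nu] are integrals over the first coordinate and are added under one integral
    sign; the sum is the slice, and [h] is a measurable function equal to it almost everywhere. *)
Lemma nu_rect_integral (alpha beta x y : R) (h : R -> R)
    (a0 : 0 < alpha) (b01 : 0 <= beta <= 1) : 0 <= x -> 0 <= y ->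
  measurable_fun setT h -> (forall t, 0 <= h t) ->
  (forall t, 0 < t < 1 -> (1 - beta) * t != alpha -> beta * (1 - t) != alpha ->
     slice alpha beta t y = h t) ->
  (nu a0 b01 (rect x y) =
    \int[lambda]_(t in `[0%R, (Num.min x 1)%R[) (h t)%:E)%E.
Proof.
move=> x0 y0 mh h0 hE.
set A := rect x y; set U := region_se alpha beta `|` region_nw alpha beta.
have mA : measurable (A : set plane) by exact: measurable_rect.
have mU : measurable (U : set plane).
  by apply: measurableU; [exact: measurable_region_se|exact: measurable_region_nw].
have mAU : measurable (A `&` U : set plane) by exact: measurableI.
rewrite /nu /nu_formula -/A -/U /graph_integral !(integral_mkcond (_ `&` _)).
have -> : lambda2 (A `&` U) = (\int[lambda]_t lambda (xsection (A `&` U) t))%E by [].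
set s1 := fun t => lambda (xsection (A `&` U) t).
set I2 := dom_se alpha beta `&` _; set s2 := _ \_ I2.
set I3 := dom_nw alpha beta `&` _; set s3 := _ \_ I3.
set I4 := dom_diag alpha beta `&` _; set s4 := _ \_ I4.
have ms1 : measurable_fun setT s1 by exact: measurable_fun_xsection.
have mI2 : measurable I2.
  apply: (measurable_graph_preimage _ _ mA); first exact: measurable_dom_se.
  exact: measurable_funS (measurable_itv _) (@dom_se_le1 _ alpha beta)
    (measurable_curve_se a0 b01).
have mI3 : measurable I3.
  apply: (measurable_graph_preimage _ _ mA); first exact: measurable_dom_nw.
  exact: measurable_funS (measurable_itv _) (@dom_nw_ge0 _ alpha beta)
    (measurable_curve_nw a0 b01).
have mI4 : measurable I4.
  apply: (measurable_graph_preimage _ _ mA); first exact: measurable_dom_diag.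
  by apply: measurable_funB => //; exact: measurable_cst.
have ms2 : measurable_fun setT s2.
  apply/(measurable_restrictT _ mI2)/measurable_EFinP.
  apply: measurable_funB; first exact: measurable_cst.
  apply: measurable_funS (measurable_itv _) _ (measurable_curve_se a0 b01).
  by move=> t [/dom_se_le1].
have ms3 : measurable_fun setT s3.
  apply/(measurable_restrictT _ mI3)/measurable_EFinP.
  apply: measurable_funS (measurable_itv _) _ (measurable_curve_nw a0 b01).
  by move=> t [/dom_nw_ge0].
have ms4 : measurable_fun setT s4.
  by apply/(measurable_restrictT _ mI4)/measurable_EFinP; exact: measurable_cst.
have s10 t : (0 <= s1 t)%E by exact: measure_ge0.
have s20 t : (0 <= s2 t)%E.
  apply: erestrict_ge0 => {}t [[_ t1] _]; rewrite lee_fin.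
  by have [_ /ltW] := curve_seE a0 b01 t1; rewrite subr_ge0.
have s30 t : (0 <= s3 t)%E.
  apply: erestrict_ge0 => {}t [[t1 _] _]; rewrite lee_fin.
  by have [/ltW] := curve_nwE a0 b01 t1.
have s40 t : (0 <= s4 t)%E by apply: erestrict_ge0 => {}t _; rewrite lee_fin.
rewrite -ge0_integralD//= -ge0_integralD//=; last 2 first.
- by move=> t _; exact: adde_ge0.
- exact: emeasurable_funD.
rewrite -ge0_integralD//=; last 2 first.
- by move=> t _; do 2 apply: adde_ge0 => //.
- by do 2 apply: emeasurable_funD => //.
rewrite [RHS]integral_mkcond.
apply: ge0_ae_eq_integral => //.
- by do 3 apply: emeasurable_funD => //.
- by apply/(measurable_restrictT _ (measurable_itv _))/measurable_EFinP;
  exact: measurable_funS mh.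
- by move=> t _; do 3 apply: adde_ge0 => //.
- by move=> t _; apply: erestrict_ge0 => {}t _; rewrite lee_fin.
(* The exceptional points are the ends of the unit interval and of the zones. With a zero
   denominator these expressions are 0 and 1, and the equation they stand for has no solution since
   alpha > 0. *)
pose r1 := alpha / (1 - beta); pose r2 := 1 - alpha / beta.
exists [set` [:: 0; 1; r1; r2]]; split.
- apply: countable_measurable; first by move=> t; exact: measurable_set1.
  by apply: finite_set_countable; exact: finite_seq.
- by apply: countable_lebesgue_measure0; apply: finite_set_countable; exact: finite_seq.
move=> t /=; apply: contra_notP => /negP; rewrite !inE !negb_or => /and4P[t0 t1 tr1 tr2] _.
have nw_le1 : alpha <= beta * (1 - t) -> t <= 1.
  move=> at1; rewrite leNgt; apply/negP => gt1.
  suff : beta * (1 - t) <= 0 by lra.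
  by rewrite mulr_ge0_le0//; [case/andP: b01|lra].
have [/andP[/andP[tge0 tx] tle1]|out] := boolP ((0 <= t < x) && (t <= 1)); last first.
  have -> : xsection (A `&` U) t = set0.
    rewrite -subset0 => z; rewrite /xsection /= inE => -[[/= +] _ Uz].
    rewrite in_itv /= => tx; move/negP: out; apply; rewrite tx /=.
    by case: Uz => [/(region_seE a0 b01)[]//|/(region_nwE a0 b01)[_ /nw_le1]].
  rewrite measure0 add0e /s2 /s3 /s4 !patchN ?adde0//; apply/negP; rewrite inE /=.
  - rewrite in_itv /= lt_min => /and3P[h1 h2 h3].
    by move/negP: out; apply; rewrite h1 h2 ltW.
  - case=> /(dom_diagE a0 b01)[/andP[_ t1'] _ _] [/=]; rewrite in_itv /= => tx _.
    by move/negP: out; apply; rewrite tx.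
  - case=> /(dom_nwE a0 b01)[_ _ /nw_le1 ?] [/=]; rewrite in_itv /= => tx _.
    by move/negP: out; apply; rewrite tx.
  - case=> /(dom_seE a0 b01)[_ _ t1'] [/=]; rewrite in_itv /= => tx _.
    by move/negP: out; apply; rewrite tx.
have tgt0 : 0 < t by rewrite lt_neqAle eq_sym t0.
have tlt1 : t < 1 by rewrite lt_neqAle t1.
have t01 : 0 < t < 1 by rewrite tgt0.
have ts : (1 - beta) * t != alpha.
  apply: contraNneq tr1 => at1; rewrite /r1 -at1 mulrAC divff ?mul1r//.
  by apply: contraTneq a0 => b1; rewrite -at1 b1 mul0r ltxx.
have tn : beta * (1 - t) != alpha.
  apply: contraNneq tr2 => at1; rewrite /r2 -at1 mulrAC divff ?mul1r ?subKr//.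
  by apply: contraTneq a0 => b1; rewrite -at1 b1 mul0r ltxx.
have [cs0 _ _] := curve_seE a0 b01 tle1.
have [/ltW cn0 _ _] := curve_nwE a0 b01 tge0.
rewrite [RHS]patchT; last by rewrite inE /= in_itv /= tge0 lt_min tx.
rewrite -hE// -(slice_sum a0 b01 t01 y0 ts tn).
have At z : A (t, z) <-> 0 <= z < y.
  by rewrite /A /rect /= !in_itv /= tge0 tx; split=> [[]|].
congr (_ + _ + _ + _)%E.
- congr (lambda _); apply/seteqP; split=> z; rewrite /xsection /nu_section /= inE.
    by case=> /At ? ?.
  by case=> ? ?; split => //; apply/At.
- rewrite /s2 patchE; congr (if _ then _ else _); apply/idP/asboolP; rewrite inE /I2 /=.
    by case=> ? /At/andP[].
  by case=> ? ?; split => //; apply/At; rewrite cs0.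
- rewrite /s3 patchE; congr (if _ then _ else _); apply/idP/asboolP; rewrite inE /I3 /=.
    by case=> ? /At/andP[].
  by case=> ? ?; split => //; apply/At; rewrite cn0.
- rewrite /s4 patchE; congr (if _ then _ else _); apply/idP/asboolP; rewrite inE /I4 /=.
    by case=> ? /At/andP[].
  by case=> ? ?; split => //; apply/At; rewrite subr_ge0 tle1.
Qed.

End nu_rect.

Section nu_rect.
Variables (R : realType).
Notation lambda := (@lebesgue_measure R).

Lemma integral_split (h : R -> R) (a b c : R) :
  a <= b -> b <= c -> measurable_fun setT h -> (forall t, 0 <= h t) ->
  (\int[lambda]_(t in `[a, c[) (h t)%:E =
   \int[lambda]_(t in `[a, b[) (h t)%:E + \int[lambda]_(t in `[b, c[) (h t)%:E)%E.
Proof.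
move=> ab bc mh h0.
rewrite -ge0_integral_setU//=.
- congr (integral _ _ _); apply/seteqP; split=> t /=; rewrite !in_itv /=.
    by case: (ltP t b) => tb /andP[-> ->]; [left|right].
  by case=> /andP[? ?]; lra.
- by apply/measurable_EFinP; exact: measurable_funS mh.
- by move=> t _; rewrite lee_fin.
- apply/disj_setPS => t /= []; rewrite !in_itv /= => /andP[_ tb] /andP[bt _].
  by move: tb; rewrite ltNge bt.
Qed.

Lemma measurable_affine (u c : R) : measurable_fun setT (fun t : R => u + c * t).
Proof.
apply: measurable_funD; first exact: measurable_cst.
by apply: measurable_funM; [exact: measurable_cst|exact: measurable_id].
Qed.

Lemma measurable_if_affine (u1 u2 c1 c2 : R) (f g : R -> R) :
  measurable_fun setT f -> measurable_fun setT g ->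
  measurable_fun setT (fun t : R => if u1 + c1 * t < u2 + c2 * t then f t else g t).
Proof.
move=> mf mg; apply: measurable_fun_ifT => //.
by apply: measurable_fun_ltr; exact: measurable_affine.
Qed.

Lemma integral_two_slopes (h f g : R -> R) (b x : R) : 0 <= b -> 0 <= x ->
  measurable_fun setT h -> (forall t, 0 <= h t) ->
  (forall t, 0 <= t < b -> h t = f t) -> (forall t, b <= t -> h t = g t) ->
  (\int[lambda]_(t in `[0%R, x[) (h t)%:E =
   \int[lambda]_(t in `[0%R, (Num.min x b)%R[) (f t)%:E +
   \int[lambda]_(t in `[(Num.min x b)%R, x[) (g t)%:E)%E.
Proof.
move=> b0 x0 mh h0 hf hg.
have m0 : 0 <= Num.min x b by rewrite le_min x0.
have mx : Num.min x b <= x by rewrite ge_min lexx.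
rewrite (integral_split m0 mx mh h0); congr (_ + _)%E; apply: eq_integral => t;
  rewrite inE /= in_itv /= => /andP[].
- by rewrite lt_min => t0 /andP[_ tb]; rewrite hf// t0.
- by rewrite ge_min leNgt => /orP[/negP//|bt] tx; rewrite hg.
Qed.

(** For fixed y the height is piecewise a maximum of two affine functions of x, with one change of
    formula at [b]; the slices are its slopes and are integrated piece by piece. *)
Lemma nu_rect (alpha beta x y : R) (a0 : 0 < alpha) (b01 : 0 <= beta <= 1) :
  0 <= x -> 0 <= y ->
  nu a0 b01 (rect x y) = (limit_height alpha beta (Num.min x 1) (Num.min y 1))%:E.
Proof.
move=> x0 y0; have /andP[b0 b1] := b01.
set xm := Num.min x 1; set ym := Num.min y 1.
have xm0 : 0 <= xm by rewrite le_min x0 ler01.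
have ym0 : 0 <= ym by rewrite le_min y0 ler01.
have xm1 : xm <= 1 by rewrite ge_min lexx orbT.
have ym1 : ym <= 1 by rewrite ge_min lexx orbT.
rewrite /limit_height; case: (leP (1 - beta) ym) => yb.
  (* [b] is where beta (1 - t) falls to alpha. For beta <= alpha this happens at no positive t, and
     0 replaces it, which also covers beta = 0. *)
  pose r := alpha / beta; pose b := if beta <= alpha then 0 else 1 - r.
  pose f t := if 0 + 0 * t < - ((1 - ym) * r) + ym * t then ym else 0.
  pose g t := if 0 + 0 * t < ym - 1 + 1 * t then 1 else 0 : R.
  pose h t := if alpha + 0 * t < beta + - beta * t then f t else g t.
  have r0 : 0 <= r by rewrite divr_ge0// ltW.
  have bp : alpha < beta -> 0 < beta by exact: lt_trans.
  have rb : alpha < beta -> beta * r = alpha.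
    by move=> /bp ?; rewrite /r; field; rewrite gt_eqF.
  have cond t : 0 <= t -> (alpha + 0 * t < beta + - beta * t) = (t < b).
    move=> t0; rewrite /b; case: (leP beta alpha) => ba.
      have bt : 0 <= beta * t by exact: mulr_ge0.
      by apply/idP/idP => tb; lra.
    rewrite -[RHS](ltr_pM2l (bp ba)) mulrBr (rb ba).
    by apply/idP/idP; lra.
  have b_ge0 : 0 <= b.
    rewrite /b; case: (leP beta alpha) => // ba; rewrite subr_ge0.
    by rewrite -(ler_pM2l (bp ba)) (rb ba) mulr1 ltW.
  have mh : measurable_fun setT h.
    by do 2 apply: measurable_if_affine; exact: measurable_cst.
  have h0 t : 0 <= h t by rewrite /h /f /g; do ! case: ifP.
  have hE t : 0 < t < 1 -> (1 - beta) * t != alpha -> beta * (1 - t) != alpha ->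
      slice alpha beta t y = h t.
    move=> t01 ts tn; rewrite (slice_min1 y a0 b01 t01) -/ym slice_north ?yb//.
    have -> : (beta * (1 - t) <= alpha) = ~~ (alpha + 0 * t < beta + - beta * t).
      by rewrite -leNgt; apply/idP/idP; lra.
    rewrite if_neg /h /f /g -/r; congr (if _ then _ else _).
      by congr (if _ then _ else _); apply/idP/idP; lra.
    by congr (if _ then _ else _); apply/idP/idP; lra.
  rewrite (nu_rect_integral a0 b01 x0 y0 mh h0 hE) -/xm.
  rewrite (@integral_two_slopes h f g b)//; last 2 first.
  - by move=> t /andP[t0 tb]; rewrite /h cond// tb.
  - by move=> t bt; rewrite /h cond ?(le_trans b_ge0)// ltNge bt.
  have m0 : 0 <= Num.min xm b by rewrite le_min xm0.
  have mx : Num.min xm b <= xm by rewrite ge_min lexx.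
  rewrite integral_max_slope ?lexx//= integral_max_slope ?lexx ?ler01//= -EFinD.
  congr (_%:E).
  have -> : (beta * (1 - xm) <= alpha) = (b <= xm).
    by rewrite [RHS]leNgt -cond// -leNgt; apply/idP/idP; lra.
  have yr : 0 <= (1 - ym) * r by apply: mulr_ge0; lra.
  rewrite -/r !mul0r !mulr0 !mul1r !addr0 [Num.max 0 (- _)]max_l; last by lra.
  case: (leP b xm) => bx; last first.
    by rewrite subrr subr0 addr0; congr (Num.max _ _); lra.
  (* The two formulas agree at [b], so the two increments telescope. *)
  have -> : Num.max 0 (- ((1 - ym) * r) + ym * b) = Num.max 0 (ym - 1 + b).
    rewrite /b; case: ifP => _; last by congr (Num.max _ _); lra.
    by rewrite !max_l//; lra.
  by rewrite subr0 addrC subrK; congr (Num.max _ _); lra.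
have bp : 0 < 1 - beta by lra.
pose b := alpha / (1 - beta).
have bE : (1 - beta) * b = alpha by rewrite /b; field; rewrite gt_eqF.
pose f t := if 0 + 0 * t < ym - 1 + 1 * t then 1 else 0 : R.
pose g t := if - (ym * b) + ym * t < ym - 1 + 1 * t then 1 else ym : R.
pose h t := if 0 + (1 - beta) * t < alpha + 0 * t then f t else g t.
have cond t : (0 + (1 - beta) * t < alpha + 0 * t) = (t < b).
  by rewrite -[RHS](ltr_pM2l bp) bE; apply/idP/idP; lra.
have b_ge0 : 0 <= b by rewrite divr_ge0// ltW.
have mh : measurable_fun setT h.
  by do 2 apply: measurable_if_affine; exact: measurable_cst.
have h0 t : 0 <= h t by rewrite /h /f /g; do ! case: ifP.
have hE t : 0 < t < 1 -> (1 - beta) * t != alpha -> beta * (1 - t) != alpha ->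
    slice alpha beta t y = h t.
  move=> t01 ts tn; rewrite (slice_min1 y a0 b01 t01) -/ym slice_south ?ym0//.
  have -> : ((1 - beta) * t <= alpha) = (0 + (1 - beta) * t < alpha + 0 * t).
    by rewrite add0r mul0r addr0 lt_neqAle ts.
  rewrite /h /f /g -/b; congr (if _ then _ else _).
    by congr (if _ then _ else _); apply/idP/idP; lra.
  by congr (if _ then _ else _); apply/idP/idP; lra.
rewrite (nu_rect_integral a0 b01 x0 y0 mh h0 hE) -/xm.
rewrite (@integral_two_slopes h f g b)//; last 2 first.
- by move=> t /andP[t0 tb]; rewrite /h cond// tb.
- by move=> t bt; rewrite /h cond ltNge bt.
have m0 : 0 <= Num.min xm b by rewrite le_min xm0.
have mx : Num.min xm b <= xm by rewrite ge_min lexx.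
rewrite integral_max_slope ?lexx ?ler01//= integral_max_slope ?ym0//= -EFinD.
congr (_%:E).
have -> : ((1 - beta) * xm <= alpha) = (xm <= b).
  by rewrite -[RHS](ler_pM2l bp) bE.
rewrite -/b !mul0r !mulr0 !mul1r !addr0 [Num.max 0 (ym - 1)]max_l; last by lra.
case: (leP xm b) => bx.
  by rewrite subrr addr0 subr0; congr (Num.max _ _); lra.
have -> : - (ym * b) + ym * b = 0 by ring.
by rewrite subr0 addrC subrK; congr (Num.max _ _); lra.
Qed.

End nu_rect.

(** * Step approximations of integrals on the square *)

Section step_approximation.
Context d (T : measurableType d) (R : realType) (J : finType).
Variables (B : J -> set T) (c : J -> R).
Hypotheses (mB : forall j, measurable (B j)) (dB : forall i j t, B i t -> B j t -> i = j).

Definition step (t : T) : R := \sum_j c j * \1_(B j) t.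

Lemma stepE j t : B j t -> step t = c j.
Proof.
move=> Bt; rewrite /step (bigD1 j)//= indicE mem_set// mulr1 big1 ?addr0// => i ij.
by rewrite indicE memNset ?mulr0// => Bi; move/eqP: ij; apply; exact: dB Bi Bt.
Qed.

Lemma measurable_step D : measurable_fun D step.
Proof.
apply: measurable_sum => j; apply: measurable_funM; first exact: measurable_cst.
exact: measurable_indic.
Qed.

(** Used with the half-open squares of a permutation for [pi_perm] and with grid cells for [nu]. The
    sets need to cover [D] only up to a null set, since the squares of a permutation leave most of
    the unit square uncovered. *)
Lemma Rintegral_step_approx (mu : {measure set T -> \bar R}) (D : set T) (f : T -> R) (K
  e : R) :
  measurable D -> (mu D < +oo)%E -> measurable_fun D f ->
  (forall t, D t -> `|f t| <= K) -> mu (D `\` \bigcup_j B j) = 0%E -> 0 <= e ->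
  (forall j t, D t -> B j t -> `|f t - c j| <= e) ->
  `|\int[mu]_(t in D) f t - \sum_j c j * fine (mu (B j `&` D))| <= e * fine (mu D).
Proof.
move=> mD muD mf fK nullB e0 fc.
have muDfin : mu D \is a fin_num by rewrite ge0_fin_numE.
have intf : mu.-integrable D (EFin \o f).
  apply: measurable_bounded_integrable => //.
  exists K; split; first exact: num_real.
  by move=> x Kx t Dt; apply: le_trans (ltW Kx); exact: fK.
have intj j : mu.-integrable D (EFin \o (fun t => c j * \1_(B j) t)).
  apply: measurable_bounded_integrable => //.
    by apply: measurable_funM; [exact: measurable_cst|exact: measurable_indic].
  exists `|c j|; split; first exact: num_real.
  move=> x cx t Dt /=; apply: le_trans (ltW cx).
  by rewrite normrM ler_piMr// indicE; case: (_ \in _); rewrite /= ?normr1 ?normr0.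
have ints : mu.-integrable D (EFin \o step).
  rewrite (_ : _ \o _ = (fun t => \sum_j (EFin \o (fun t => c j * \1_(B j) t)%R) t)%E).
    by apply: integrable_sum.
  by apply/funext => t /=; rewrite sumEFin.
have -> : \sum_j c j * fine (mu (B j `&` D)) = \int[mu]_(t in D) step t.
  rewrite /Rintegral.
  under eq_integral do rewrite /step -sumEFin.
  rewrite integral_sum// -sum_fine; last first.
    by move=> j _; apply: integrable_fin_num => //; exact: intj.
  apply: eq_bigr => j _.
  under eq_integral do rewrite EFinM.
  rewrite integralZl//; last first.
    apply: (@measurable_bounded_integrable _ _ _ _ (\1_(B j) : T -> R)) => //.
    exists 1; split; first exact: num_real.
    move=> x x1 t _ /=; apply: le_trans (ltW x1).
    by rewrite indicE; case: (_ \in _); rewrite /= ?normr1 ?normr0.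
  rewrite integral_indic// fineM//.
  rewrite ge0_fin_numE//; apply: le_lt_trans muD; apply: le_measure; rewrite ?inE//.
  exact: measurableI.
have intfs : mu.-integrable D (EFin \o (fun t => f t - step t)).
  exact: (integrableB mD intf ints).
rewrite -RintegralB//; apply: le_trans (le_normr_Rintegral _ _) _ => //.
have mfs : measurable_fun D (fun t => f t - step t).
  by apply: measurable_funB => //; exact: measurable_step.
rewrite -(Rintegral_cst mu mD); apply: fine_le.
- apply: integrable_fin_num => //.
  exact: (integrable_abse intfs).
- by rewrite integral_cst// fin_numM.
apply: ae_ge0_le_integral => //.
- by apply/measurable_EFinP; apply: measurableT_comp.
- exists (D `\` \bigcup_j B j); split => //.
    apply: measurableD => //; apply: fin_bigcup_measurable => //.
  move=> t /=; apply: contra_notP => /not_andP[nD|].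
    by move=> Dt; case: nD.
  move=> /contrapT[j _ Bt] Dt; rewrite lee_fin (stepE Bt); exact: fc.
Qed.

End step_approximation.

(** * Continuous functions on the unit square and grid cells *)

Section continuous_on_square.
Variable R : realType.
Notation plane := (measurableTypeR R * measurableTypeR R)%type.
Local Notation square := (@unit_square R).
Variable f : R * R -> R.
Hypothesis f_cont : {within square, continuous f}.

Lemma compact_unit_square : compact square.
Proof. by apply: compact_setX; exact: segment_compact. Qed.

(** A Lebesgue number argument: around each point half of the radius of continuity is kept for p,
    the other half for the distance from p to q, and compactness makes the radius uniform. *)
Lemma unif_cont_square (e : R) : 0 < e -> exists2 r : R, 0 < r &
  forall p q, square p -> square q -> `|p.1 - q.1| < r -> `|p.2 - q.2| < r ->
    `|f p - f q| <= e.
Proof.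
move=> e0.
have /compact_near_coveringP/(_ nat \oo (fun n p => square p -> forall q, square q ->
    `|p.1 - q.1| < n.+1%:R^-1 -> `|p.2 - q.2| < n.+1%:R^-1 -> `|f p - f q| <= e) _) :=
  compact_unit_square.
case.
- move=> x sx.
  have e20 : 0 < e / 2 by lra.
  have /subspace_continuousP/(_ _ sx)/cvgrPdist_le/(_ _ e20) := f_cont.
  rewrite near_withinE => /nbhs_ballP[r /= r0 xr].
  have r20 : 0 < r / 2 by lra.
  exists (ball x (r / 2), [set n | n.+1%:R^-1 < r / 2]).
    split; first exact: nbhsx_ballx.
    exact: (near_infty_natSinv_lt (PosNum r20)).
  move=> [p n] /= [xp nr] sp q sq pq1 pq2.
  have xq : ball x r q.
    have pq : ball p (r / 2) q.
      by split => /=; rewrite /ball /=; [exact: lt_trans pq1 nr|exact: lt_trans pq2 nr].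
    by have := ball_triangle xp pq; rewrite -splitr.
  have xp' : ball x r p by apply: le_ball xp; lra.
  have := xr _ xp' sp; have := xr _ xq sq.
  have -> : f p - f q = - (f x - f p) + (f x - f q) by ring.
  move=> h1 h2; rewrite (le_trans (ler_normD _ _))// normrN; lra.
move=> N _ /(_ N (leqnn N)) H; exists N.+1%:R^-1; first by rewrite invr_gt0.
by move=> p q sp sq; exact: (H p sp sp q sq).
Qed.

Lemma bounded_square : exists K : R, forall p, square p -> `|f p| <= K.
Proof.
have /compact_bounded[M [_ MP]] : compact (f @` square).
  by apply: continuous_compact => //; exact: compact_unit_square.
by exists (M + 1) => p sp; apply: (MP (M + 1)); [rewrite ltrDl|exists p].
Qed.

End continuous_on_square.

Section cells.
Variable R : realType.
Notation plane := (measurableTypeR R * measurableTypeR R)%type.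
Local Notation square := (@unit_square R).
Variable N : nat.
Local Notation J := ('I_N.+2 * 'I_N.+2)%type.

Definition node (k : nat) : R := k%:R / N.+1%:R.
Definition corner (j : J) : R * R := (node j.1, node j.2).
(** Half-open cells of side 1 / (N + 1). The index N + 1 adds the cells starting at coordinate 1,
    which cover the right and upper edges of the square; hence the outermost nodes exceed 1. *)
Definition cell (j : J) : set (R * R) :=
  `[node j.1, node j.1.+1[ `*` `[node j.2, node j.2.+1[.

Lemma node_truncn (x : R) (k : nat) : 0 <= x ->
  (x \in `[node k, node k.+1[) = (k == Num.truncn (N.+1%:R * x)).
Proof.
move=> x0; rewrite in_itv /= /node ler_pdivrMr// ltr_pdivlMr//.
rewrite eq_sym -truncn_eq ?mulr_ge0//.
by rewrite mulrC.
Qed.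

Lemma measurable_cell j : measurable (cell j : set plane).
Proof. by apply: measurableX; exact: measurable_itv. Qed.

Lemma node_ge0 k : 0 <= node k. Proof. by rewrite divr_ge0. Qed.

Lemma cell_disjoint i j p : cell i p -> cell j p -> i = j.
Proof.
case: p => x y [/= ix iy] [/= jx jy].
have x0 : 0 <= x by move: ix; rewrite in_itv /= => /andP[/(le_trans (node_ge0 _))].
have y0 : 0 <= y by move: iy; rewrite in_itv /= => /andP[/(le_trans (node_ge0 _))].
move: ix iy jx jy; rewrite !node_truncn// => /eqP i1 /eqP i2 /eqP j1 /eqP j2.
rewrite (surjective_pairing i) (surjective_pairing j).
by congr (_, _); apply/val_inj; rewrite /= ?i1 ?i2 ?j1 ?j2.
Qed.

Lemma corner_square j : square (corner j).
Proof.
by split; rewrite /= in_itv /= node_ge0 ler_pdivrMr// mul1r ler_nat -ltnS ltn_ord.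
Qed.

Lemma cell_cover p : square p -> exists j, cell j p.
Proof.
case: p => x y [] /=; rewrite !in_itv /= => /andP[x0 x1] /andP[y0 y1].
have lt2 (z : R) : 0 <= z -> z <= 1 -> (Num.truncn (N.+1%:R * z) < N.+2)%N.
  move=> z0 z1; rewrite ltnS -(ler_nat R).
  have z0' : 0 <= N.+1%:R * z by rewrite mulr_ge0.
  have /andP[/le_trans-> //] := truncn_itv z0'.
  by rewrite ler_piMr.
by exists (Ordinal (lt2 x x0 x1), Ordinal (lt2 y y0 y1)); split; rewrite /= node_truncn.
Qed.

Lemma cell_mesh j p : cell j p ->
  `|p.1 - (corner j).1| < N.+1%:R^-1 /\ `|p.2 - (corner j).2| < N.+1%:R^-1.
Proof.
have nS k : node k.+1 = node k + N.+1%:R^-1 by rewrite /node -natr1 mulrDl mul1r.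
case: p => x y [] /=; rewrite !in_itv /= !nS => /andP[? ?] /andP[? ?].
by rewrite /corner /=; split; rewrite ger0_norm ?ltrBlDl ?subr_ge0.
Qed.

End cells.

Section weak_limit.
Variable R : realType.
Notation lambda := (@lebesgue_measure R).
Notation plane := (measurableTypeR R * measurableTypeR R)%type.
Local Notation square := (@unit_square R).

Lemma measurable_square : measurable (square : set plane).
Proof. by apply: measurableX; exact: measurable_itv. Qed.

(** On the square, f is the pointwise limit of the step functions with its corner values. *)
Lemma measurable_on_square (f : plane -> R) : {within square, continuous f} ->
  measurable_fun (square : set plane) f.
Proof.
move=> cf.
apply: (@measurable_fun_cvg _ _ _ _ (fun N => step (@cell R N) (fun j => f (corner R j)))).
  by move=> N; apply: measurable_step => j; exact: measurable_cell.
move=> p sp; apply/cvgrPdist_le => e e0.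
have [r r0 fr] := unif_cont_square cf e0.
apply: filterS (near_infty_natSinv_lt (PosNum r0)) => N /= Nr.
have [j jp] := cell_cover N sp.
rewrite (stepE _ (@cell_disjoint R N) jp).
have [m1 m2] := cell_mesh jp.
by apply: fr => //; [exact: corner_square|exact: lt_trans m1 Nr|exact: lt_trans m2 Nr].
Qed.

(** Inclusion-exclusion, in additive form to avoid differences of possibly infinite measures. *)
Lemma measure_cell_rect (mu : {measure set plane -> \bar R}) (a b c d : R) :
  0 <= a <= b -> 0 <= c <= d ->
  (mu (rect b d) + mu (rect a c) =
   mu (rect a d) + mu (rect b c) + mu (`[a, b[ `*` `[c, d[))%E.
Proof.
move=> /andP[a0 ab] /andP[c0 cd].
have mI (x y z w : R) : measurable (`[x, y[ `*` `[z, w[ : set plane).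
  by apply: measurableX; exact: measurable_itv.
have splitx (z w : R) : mu (`[0, b[ `*` `[z, w[) =
    (mu (`[0%R, a[ `*` `[z, w[) + mu (`[a, b[ `*` `[z, w[))%E.
  rewrite -measureU//; last first.
    by rewrite -subset0 => -[x y] [[/=]];
      rewrite !in_itv /= => /andP[? ?] _ [/andP[? ?] _]; lra.
  congr (mu _); apply/seteqP; split=> -[x y] /=; rewrite !in_itv /=.
    by move=> [/andP[x0 xb] yz]; case: (ltP x a) => xa; [left|right]; rewrite ?x0 ?xb.
  by case=> -[/andP[? ?] yz]; split => //; lra.
have splity (z w : R) : mu (`[z, w[ `*` `[0, d[) =
    (mu (`[z, w[ `*` `[0%R, c[) + mu (`[z, w[ `*` `[c, d[))%E.
  rewrite -measureU//; last first.
    by rewrite -subset0 => -[x y] [[/= _]];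
      rewrite !in_itv /= => /andP[? ?] [_ /andP[? ?]]; lra.
  congr (mu _); apply/seteqP; split=> -[x y] /=; rewrite !in_itv /=.
    by move=> [xz /andP[y0 yb]]; case: (ltP y c) => yc; [left|right]; rewrite ?y0 ?yb.
  by case=> -[xz /andP[? ?]]; split => //; lra.
rewrite /rect (splitx 0 d) (splitx 0 c) (splity a b).
by rewrite -!addeA; congr (_ + _)%E; rewrite [RHS]addeC addeA.
Qed.

(** * Masses of the grid cells under [nu] *)

Section nu_cells.
Variables (alpha beta : R) (a0 : 0 < alpha) (b01 : 0 <= beta <= 1).
Local Notation nu := (nu a0 b01).
Definition clipped_height (x y : R) : R := limit_height alpha beta (Num.min x 1) (Num.min
  y 1).
(** The mixed second difference, which recovers the mass of a cell from a distribution function. It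
    is applied to the limiting height, to the height of a permutation and to indicators of
    rectangles. *)
Definition cell_mass (F : R -> R -> R) N (j : 'I_N.+2 * 'I_N.+2) : R :=
  F (node R N j.1.+1) (node R N j.2.+1) + F (node R N j.1) (node R N j.2)
  - F (node R N j.1) (node R N j.2.+1) - F (node R N j.1.+1) (node R N j.2).

Let nu_setDI (A B : set plane) : measurable A -> measurable B ->
  nu A = (nu (A `\` B) + nu (A `&` B))%E.
Proof. exact: measureDI. Qed.

Lemma nu_rect_large (x y : R) : 1 <= x -> 1 <= y -> nu (rect x y) = 1%E.
Proof.
move=> x1 y1; rewrite nu_rect ?(le_trans ler01)// !min_r//.
rewrite /limit_height gerBl; have /andP[-> _] := b01.
by rewrite subrr mulr0 ltW// max_r//; congr (_%:E); lra.
Qed.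

(* [rect 1 1] already carries the whole mass of [nu]. *)
Lemma nu_outside_square (S : set plane) : measurable S -> S `<=` rect 2 2 ->
  nu (S `\` square) = 0%E.
Proof.
move=> mS S2.
have r12 : rect 1 1 `<=` (rect 2 2 : set (R * R)).
  by move=> [x y] [/=]; rewrite !in_itv /= => /andP[? ?] /andP[? ?]; split;
    rewrite /= in_itv /=; lra.
have : nu (rect 2 2 `\` rect 1 1) = 0%E.
  have := nu_setDI (measurable_rect 2 2) (measurable_rect 1 1).
  rewrite setIidr// !nu_rect_large ?lexx ?ler1n//.
  case: (nu (_ `\` _)) => [x| |] //=; rewrite -EFinD => -[] x1.
  by congr (_%:E); lra.
apply: subset_measure0 => /=.
- by apply: measurableD => //; exact: measurable_square.
- by apply: measurableD; exact: measurable_rect.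
- move=> p [/S2 ? ns]; split => // -[/=]; rewrite !in_itv /= => /andP[? ?] /andP[? ?].
  by apply: ns; split; rewrite /= in_itv /=; lra.
Qed.

Lemma nu_square : nu square = 1%E.
Proof.
have s2 : square `<=` rect 2 2.
  by move=> [x y] [/=]; rewrite !in_itv /= => /andP[? ?] /andP[? ?]; split;
    rewrite /= in_itv /=; lra.
have := nu_setDI (measurable_rect 2 2) measurable_square.
rewrite setIidr// nu_outside_square//; last exact: measurable_rect.
by rewrite add0e nu_rect_large ?ler1n.
Qed.

Lemma nu_cell N j : nu (@cell R N j `&` square) = (cell_mass clipped_height j)%:E.
Proof.
have node2 k : (k <= N.+2)%N -> node R N k <= 2.
  by move=> kN; rewrite ler_pdivrMr// -natrM ler_nat; lia.
have nodeS k : 0 <= node R N k <= node R N k.+1.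
  by rewrite node_ge0 ler_wpM2r ?invr_ge0// ler_nat.
have -> : nu (cell j `&` square) = nu (cell j).
  have := nu_setDI (@measurable_cell R N j) measurable_square.
  rewrite nu_outside_square ?add0e//; first exact: measurable_cell.
  move=> [x y] [/=]; rewrite !in_itv /= => /andP[? ?] /andP[? ?].
  have := node2 j.1.+1 (ltn_ord _); have := node2 j.2.+1 (ltn_ord _).
  have := node_ge0 R N j.1; have := node_ge0 R N j.2.
  by split; rewrite /= in_itv /=; lra.
have : (nu (rect (node R N j.1.+1) (node R N j.2.+1)) + nu (rect (node R N j.1) (node R N
  j.2)) =
    nu (rect (node R N j.1) (node R N j.2.+1)) + nu (rect (node R N j.1.+1) (node R N
      j.2)) +
    nu (cell j))%E := measure_cell_rect nu (nodeS j.1) (nodeS j.2).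
rewrite !nu_rect ?node_ge0// -!EFinD -/(cell j) /cell_mass /clipped_height.
case: (nu (cell j)) => [x| |] //=; rewrite -?EFinD => -[] h.
by congr (_%:E); lra.
Qed.

End nu_cells.
End weak_limit.

(** * The permuton of a permutation *)

Section permuton_sums.
Variable R : realType.
Notation lambda := (@lebesgue_measure R).
Notation plane := (measurableTypeR R * measurableTypeR R)%type.
Local Notation square := (@unit_square R).

(* The number of [k < n] such that [k / n < x]. *)
Definition grid_index (n : nat) (x : R) : nat :=
  minn n (Num.truncn (x * n%:R) + ((Num.truncn (x * n%:R))%:R < x * n%:R)%R).

Lemma grid_indexP n (x : R) (k : nat) : 0 <= x -> (k < n)%N ->
  (k < grid_index n x)%N = (k%:R / n%:R < x).
Proof.
move=> x0 kn; have n0 : 0 < n%:R :> R by rewrite ltr0n; lia.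
rewrite ltr_pdivrMr// leq_min kn /=.
have z0 : 0 <= x * n%:R by rewrite mulr_ge0.
have := truncn_itv z0; move: (Num.truncn _) => t /andP[tz zt].
have [kt|tk|->] := ltngtP k t.
- rewrite ltn_addr//; apply/esym; apply: lt_le_trans tz; by rewrite ltr_nat.
- apply/idP/idP; first by case: (_ < _) => /=; lia.
  move=> kz; have := lt_trans kz zt; rewrite ltr_nat; lia.
- by case: (_ < _) => /=; lia.
Qed.

Lemma grid_index_le n (x : R) : (grid_index n x <= n)%N.
Proof. exact: geq_minl. Qed.

Lemma grid_index_near n (x : R) : 0 <= x ->
  `|(grid_index n x)%:R - Num.min x 1 * n%:R| <= 1.
Proof.
move=> x0; rewrite /grid_index.
have z0 : 0 <= x * n%:R by rewrite mulr_ge0.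
have -> : Num.min x 1 * n%:R = Num.min (x * n%:R) n%:R.
  by rewrite minr_pMl// mul1r.
have := truncn_itv z0; move: (Num.truncn _) => t /andP[tz]; rewrite -natr1 => zt.
set s := (t + _)%N.
have sz : `|s%:R - x * n%:R| <= 1 :> R.
  rewrite /s natrD ler_norml; case: ltP => /= h; lra.
move: sz; rewrite !ler_norml => /andP[s1 s2].
have -> : (minn n s)%:R = Num.min n%:R s%:R :> R.
  by case: (leqP n s) => h; [rewrite min_l// ler_nat|rewrite min_r// ler_nat ltnW].
by case: (leP n%:R s%:R) => ?; case: (leP (x * n%:R) n%:R) => ?; lra.
Qed.

Section permutation.
Variables (n : nat) (u : 'S_n).
Hypothesis n_gt0 : (0 < n)%N.

Let nR : 0 < n%:R :> R. Proof. by rewrite ltr0n. Qed.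

Definition perm_point (i : 'I_n) : R * R := (i%:R / n%:R, (u i)%:R / n%:R).

Lemma perm_point_rect i (x y : R) : 0 <= x -> 0 <= y ->
  (perm_point i \in rect x y) = (i < grid_index n x)%N && (u i < grid_index n y)%N.
Proof.
move=> x0 y0; rewrite !grid_indexP//.
by apply/idP/andP; rewrite inE /rect /= !in_itv /= !divr_ge0.
Qed.

(** Identifies the height, divided by n, with the distribution function of the uniform measure on
    the points of the permutation. *)
Lemma sum_perm_point_rect (x y : R) : 0 <= x -> 0 <= y ->
  \sum_i \1_(rect x y) (perm_point i) = (height (grid_index n y) u (grid_index n x))%:R
    :> R.
Proof.
move=> x0 y0; rewrite /height natr_sum [RHS]big_mkcond /=.
by apply: eq_bigr => i _; rewrite indicE perm_point_rect//; case: (_ < _)%N.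
Qed.

(** The closed squares may meet along their boundaries; these versions are disjoint and differ from
    them by null sets. *)
Definition half_open_square (i : 'I_n) : set (R * R) :=
  `[i%:R / n%:R, i.+1%:R / n%:R[ `*` `[(u i)%:R / n%:R, (u i).+1%:R / n%:R[.

Lemma measurable_half_open_square i : measurable (half_open_square i : set plane).
Proof. by apply: measurableX; exact: measurable_itv. Qed.

Lemma lambda2X (A B : set (measurableTypeR R)) : measurable A -> measurable B ->
  lambda2 (A `*` B) = (lambda A * lambda B)%E.
Proof. exact: product_measure1E. Qed.

Let lt_frac (k : nat) : (k%:R / n%:R < k.+1%:R / n%:R :> R).
Proof. by rewrite ltr_pM2r ?invr_gt0// ltr_nat. Qed.

Let frac_sub (k : nat) : k.+1%:R / n%:R - k%:R / n%:R = n%:R^-1 :> R.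
Proof. by rewrite -mulrBl -natr1 addrC addKr mul1r. Qed.

Lemma lambda2_half_open_square i : lambda2 (half_open_square i) = (n%:R^-1 * n%:R^-1)%:E.
Proof.
by rewrite lambda2X//= !lebesgue_measure_itv /= !lte_fin !lt_frac -!EFinB !frac_sub.
Qed.

Lemma lambda2_perm_square i : lambda2 (@perm_square R n u i) = (n%:R^-1 * n%:R^-1)%:E.
Proof.
by rewrite lambda2X//= !lebesgue_measure_itv /= !lte_fin !lt_frac -!EFinB !frac_sub.
Qed.

Lemma measurable_perm_square i : measurable (@perm_square R n u i : set plane).
Proof. by apply: measurableX; exact: measurable_itv. Qed.

Lemma perm_square_edges_null i :
  lambda2.-negligible (@perm_square R n u i `\` half_open_square i).
Proof.
exists (([set i.+1%:R / n%:R] `*` setT) `|` (setT `*` [set (u i).+1%:R / n%:R])); split.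
- by apply: measurableU; apply: measurableX => //; exact: measurable_set1.
- apply/eqP; rewrite -measure_le0; apply: (le_trans (measureU2 _ _ _)).
  + by apply: measurableX => //; exact: measurable_set1.
  + by apply: measurableX => //; exact: measurable_set1.
  + have := @lambda2X [set i.+1%:R / n%:R] setT (measurable_set1 _) measurableT.
    have := @lambda2X setT [set (u i).+1%:R / n%:R] measurableT (measurable_set1 _).
    rewrite !lebesgue_measure_set1 mul0e mule0 /= => h1 h2.
    by rewrite [X in (X + _)%E]h2 [X in (_ + X)%E]h1 adde0.
- move=> [x y] [[/=]]; rewrite !in_itv /= => /andP[x1 x2] /andP[y1 y2].
  rewrite /half_open_square /= !in_itv /= x1 y1 /= => /not_andP.
  by case=> /negP; rewrite -leNgt => h; [left|right]; split => //=; apply/le_anti/andP.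
Qed.

Lemma pi_permE (A : set plane) : pi_perm u A = (n%:R%:E * lambda2 (A `&` perm_support u))%E.
Proof. by []. Qed.

Lemma half_open_square_sub i : half_open_square i `<=` square.
Proof.
have le1 (k : 'I_n) : k.+1%:R / n%:R <= 1 :> R by rewrite ler_pdivrMr// mul1r ler_nat.
have ge0 (k : 'I_n) : 0 <= k%:R / n%:R :> R by rewrite divr_ge0.
move=> [x y] [/=]; rewrite !in_itv /= => /andP[x1 x2] /andP[y1 y2].
split; rewrite /= in_itv /= ?(le_trans (ge0 _) x1) ?(le_trans (ge0 _) y1)/=.
  exact: le_trans (ltW x2) (le1 i).
exact: le_trans (ltW y2) (le1 (u i)).
Qed.

Lemma perm_squareT i : @perm_square R n u i `<=` perm_support u.
Proof. by move=> p pi; rewrite /perm_support (bigD1 i)//=; left. Qed.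

Lemma perm_supportE p : @perm_support R n u p -> exists i, perm_square u i p.
Proof.
rewrite /perm_support; elim/big_rec: _ => // i A _ IH [pi|/IH//]; first by exists i.
Qed.

Lemma half_open_square_perm_square i : half_open_square i `<=` @perm_square R n u i.
Proof.
move=> [x y] [/=]; rewrite !in_itv /= => /andP[x1 x2] /andP[y1 y2].
by split; rewrite /= in_itv /= ?x1 ?y1 ltW.
Qed.

Lemma half_open_square_disjoint i j p :
  half_open_square i p -> half_open_square j p -> i = j.
Proof.
case: p => x y [/= + _] [/= + _]; rewrite !in_itv /= !ler_pdivrMr// !ltr_pdivlMr//.
move=> /andP[i1 i2] /andP[j1 j2]; apply/val_inj => /=.
have := le_lt_trans i1 j2; have := le_lt_trans j1 i2; rewrite !ltr_nat; lia.
Qed.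

Lemma pi_perm_half_open_square i :
  pi_perm u (half_open_square i `&` square) = (n%:R^-1 : R)%:E.
Proof.
rewrite pi_permE (setIidl (@half_open_square_sub i)) setIidl; last first.
  by apply: subset_trans (@perm_squareT i); exact: half_open_square_perm_square.
by rewrite lambda2_half_open_square -EFinM mulrA mulfV ?gt_eqF// mul1r.
Qed.

Lemma pi_perm_edges_null : pi_perm u (square `\` \bigcup_i half_open_square i) = 0%E :>
  \bar R.
Proof.
have mB : measurable (\bigcup_i half_open_square i : set plane).
  by apply: fin_bigcup_measurable => // i _; exact: measurable_half_open_square.
have neg : lambda2.-negligible (\big[setU/set0]_(i < n) (@perm_square R n u i `\`
  half_open_square i)).
  elim/big_ind: _ => //; first exact: negligible_set0.
    by move=> A B; exact: negligibleU.
  by move=> i _; exact: perm_square_edges_null.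
rewrite pi_permE (_ : lambda2 _ = 0%E) ?mule0//.
have mS : measurable ((square `\` \bigcup_i half_open_square i) `&` perm_support u : set
  plane).
  apply: measurableI; last exact: measurable_perm_support.
  by apply: measurableD => //; exact: measurable_square.
apply/(measure_negligible mS)/(negligibleS _ neg) => p [[sp nB] /perm_supportE[i pi]].
by rewrite (bigD1 i)//=; left; split => // Bp; apply: nB; exists i.
Qed.

(** Subadditivity over the n squares of area n^(-2). The total mass enters only as a factor of the
    approximation error, so an upper bound is what is required. *)
Lemma pi_perm_square_le1 : (pi_perm u square <= 1 :> \bar R)%E.
Proof.
have [_ Boole] : measurable (perm_support u : set plane) /\
    (lambda2 (perm_support u) <= \sum_(i < n) lambda2 (@perm_square R n u i))%E.
  rewrite /perm_support; elim/big_ind2: _ => [|A a B b [mA Aa] [mB Bb]|i _].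
  - by rewrite measure0; split.
  - split; first exact: measurableU.
    exact: le_trans (measureU2 _ mA mB) (leeD Aa Bb).
  - by split => //; exact: measurable_perm_square.
rewrite pi_permE.
apply: (@le_trans _ _ (n%:R%:E * \sum_(i < n) lambda2 (@perm_square R n u i)))%E.
  rewrite lee_pmul2l// ?lte_fin//; apply: le_trans Boole.
  apply: le_measure; rewrite ?inE//=; first apply: measurableI => //.
  - exact: measurable_square.
  - exact: measurable_perm_support.
  - exact: measurable_perm_support.
under eq_bigr do rewrite lambda2_perm_square.
rewrite sumEFin sumr_const card_ord -EFinM lee_fin -mulrnAr -[n%:R^-1 *+ n]mulr_natr.
by rewrite mulVf ?gt_eqF// mulr1 mulfV ?gt_eqF.
Qed.

End permutation.
End permuton_sums.

(** * Weak convergence *)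

Section comparison.
Variable R : realType.
Notation plane := (measurableTypeR R * measurableTypeR R)%type.
Local Notation square := (@unit_square R).

Lemma indic_cell N (j : 'I_N.+2 * 'I_N.+2) (p : R * R) : 0 <= p.1 -> 0 <= p.2 ->
  \1_(@cell R N j) p = cell_mass (fun x y => \1_(rect x y) p : R) j :> R.
Proof.
case: p => x y /= x0 y0; rewrite /cell_mass !indicE.
have nodeS k : node R N k <= node R N k.+1.
  by rewrite ler_wpM2r ?invr_ge0// ler_nat.
have := nodeS j.1; have := nodeS j.2.
rewrite /cell /rect /=; set a := node R N j.1; set b := node R N j.1.+1.
set c := node R N j.2; set d := node R N j.2.+1 => cd ab.
have memE (I K : interval R) : ((x, y) \in [set` I] `*` [set` K]) = (x \in I) && (y \in K).
  by apply/idP/andP => [/set_mem[]//|[xI yK]]; apply/mem_set.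
rewrite !memE !in_itv /= x0 y0 /=.
case: (ltP x a) => xa; case: (ltP x b) => xb; case: (ltP y c) => yc;
  case: (ltP y d) => yd /=; lra.
Qed.

Lemma dist_chain (a b s1 s2 s3 e t : R) : `|a - s1| <= e -> `|s1 - s2| <= e ->
  `|s2 - s3| <= t -> `|b - s3| <= e -> `|a - b| <= 3%:R * e + t.
Proof.
rewrite !ler_norml => /andP[? ?] /andP[? ?] /andP[? ?] /andP[? ?].
by apply/andP; split; lra.
Qed.

(** Four comparisons: the integral against [pi_perm] with the average of f over the points of the
    permutation ([A1]), this average with its rounding to cell corners ([A3]), the cell masses of
    the permutation with those of the limit ([A4]), and the corner sum of the limit with the
    integral against [nu] ([A2]). All but [A4] cost e by uniform continuity. *)
Lemma perm_integral_close (alpha beta : R) (a0 : 0 < alpha) (b01 : 0 <= beta <= 1)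
    (f : R * R -> R) (K e r h : R) (n N : nat) (u : 'S_n) :
  (0 < n)%N -> measurable_fun (square : set plane) f ->
  (forall p, square p -> `|f p| <= K) -> 0 < e -> n%:R^-1 < r -> N.+1%:R^-1 < r ->
  (forall p q, square p -> square q -> `|p.1 - q.1| < r -> `|p.2 - q.2| < r ->
    `|f p - f q| <= e) ->
  (forall k l : 'I_N.+3,
    `|(height (grid_index n (node R N l)) u (grid_index n (node R N k)))%:R / n%:R
      - clipped_height alpha beta (node R N k) (node R N l)| <= h) ->
  `|\int[pi_perm u]_(p in square) f p - \int[nu a0 b01]_(p in square) f p| <=
    3%:R * e + 4%:R * h * \sum_(j : 'I_N.+2 * 'I_N.+2) `|f (corner R j)|.
Proof.
move=> n0 mf fK e0 nr Nr osc hh.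
have nR : 0 < n%:R :> R by rewrite ltr0n.
pose G (x y : R) : R := (height (grid_index n y) u (grid_index n x))%:R / n%:R.
pose F := clipped_height alpha beta.
have ms : measurable (square : set plane) by exact: measurable_square.
have pp0 i : 0 <= (perm_point R u i).1 /\ 0 <= (perm_point R u i).2.
  by rewrite /= !divr_ge0.
have pps i : square (perm_point R u i).
  apply: (@half_open_square_sub R n u n0 i); split; rewrite /= in_itv /= lexx /=.
    by rewrite ltr_pM2r ?invr_gt0// ltr_nat.
  by rewrite ltr_pM2r ?invr_gt0// ltr_nat.
have A1 : `|\int[pi_perm u]_(p in square) f p - \sum_i f (perm_point R u i) * n%:R^-1| <= e.
  have pi1 : (pi_perm u square <= 1 :> \bar R)%E by exact: pi_perm_square_le1.
  have pifin : (pi_perm u square < +oo :> \bar R)%E by exact: le_lt_trans pi1 (ltry 1).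
  have -> : \sum_i f (perm_point R u i) * n%:R^-1 =
      \sum_i f (perm_point R u i) * fine (pi_perm u (@half_open_square R n u i `&` square)).
    by apply: eq_bigr => i _; rewrite pi_perm_half_open_square.
  apply: (@le_trans _ _ (e * fine (pi_perm u square : \bar R))); last first.
    apply: ler_piMr; first exact: ltW.
    by rewrite -lee_fin fineK// ge0_fin_numE.
  have H := (@Rintegral_step_approx _ _ R _ (@half_open_square R n u : 'I_n -> set plane)
    (fun i => f (perm_point R u i)) (@measurable_half_open_square R n u)
    (@half_open_square_disjoint R n u n0) (pi_perm u) square f K e).
  refine (H _ _ _ _ _ _ _) => //.
  - exact: pi_perm_edges_null.
  - exact: ltW.
  - move=> i [x y] sp [/=]; rewrite !in_itv /= => /andP[x1 x2] /andP[y1 y2].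
    have S (k : nat) : k.+1%:R / n%:R = k%:R / n%:R + n%:R^-1 :> R.
      by rewrite -natr1 mulrDl mul1r.
    rewrite !S in x2 y2; apply: osc => //=; apply: le_lt_trans nr;
      by rewrite ger0_norm ?subr_ge0// lerBlDl ltW.
have A2 : `|\int[nu a0 b01]_(p in square) f p - \sum_(j : 'I_N.+2 * 'I_N.+2) f (corner R
  j) * cell_mass F j| <= e.
  have -> : \sum_(j : 'I_N.+2 * 'I_N.+2) f (corner R j) * cell_mass F j =
      \sum_(j : 'I_N.+2 * 'I_N.+2) f (corner R j) * fine (nu a0 b01 (@cell R N j `&`
        square)).
    by apply: eq_bigr => j _; rewrite nu_cell.
  rewrite -[leRHS]mulr1 -[X in _ <= _ * X]/(fine (1%:E : \bar R)) -(nu_square a0 b01).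
  have H := (@Rintegral_step_approx _ _ R _ (@cell R N : _ -> set plane)
    (fun j => f (corner R j)) (@measurable_cell R N) (@cell_disjoint R N)
    (nu a0 b01) square f K e).
  refine (H _ _ _ _ _ _ _) => //.
  - by rewrite [ltLHS]nu_square ltry.
  - rewrite (_ : _ `\` _ = set0) ?measure0// -subset0 => p [sp]; apply.
    by have [j jp] := cell_cover N sp; exists j.
  - exact: ltW.
  - move=> j p sp jp; have [m1 m2] := cell_mesh jp.
    by apply: osc => //; [exact: corner_square|exact: lt_trans m1 Nr|exact: lt_trans m2 Nr].
have GE (j : 'I_N.+2 * 'I_N.+2) : cell_mass G j = n%:R^-1 * \sum_i \1_(@cell R N j)
  (perm_point R u i).
  have rE x y : 0 <= x -> 0 <= y ->
      G x y = n%:R^-1 * \sum_i \1_(rect x y) (perm_point R u i).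
    by move=> x0 y0; rewrite sum_perm_point_rect// mulrC.
  rewrite (eq_bigr (fun i =>
      cell_mass (fun x y => \1_(rect x y) (perm_point R u i) : R) j)); last first.
    by move=> i _; have [? ?] := pp0 i; exact: indic_cell.
  rewrite /cell_mass !sumrB big_split/= !rE ?node_ge0//.
  by ring.
have A3 : `|\sum_i f (perm_point R u i) * n%:R^-1 - \sum_(j : 'I_N.+2 * 'I_N.+2) f
  (corner R j) * cell_mass G j| <= e.
  have -> : \sum_(j : 'I_N.+2 * 'I_N.+2) f (corner R j) * cell_mass G j =
      \sum_i step (@cell R N) (fun j => f (corner R j)) (perm_point R u i) * n%:R^-1.
    under eq_bigr do rewrite GE mulrCA mulr_sumr mulr_sumr.
    rewrite exchange_big /=; apply: eq_bigr => i _.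
    by rewrite /step mulr_suml; apply: eq_bigr => j _; rewrite mulrC.
  rewrite -sumrB; apply: le_trans (ler_norm_sum _ _ _) _.
  apply: (@le_trans _ _ (\sum_(i < n) e * n%:R^-1)); last first.
    by rewrite sumr_const card_ord -[leLHS]mulr_natr divfK ?gt_eqF.
  apply: ler_sum => i _; rewrite -mulrBl normrM [`|n%:R^-1|]ger0_norm ?invr_ge0//.
  rewrite ler_wpM2r ?invr_ge0//.
  have [j jp] := cell_cover N (pps i).
  rewrite (stepE _ (@cell_disjoint R N) jp).
  have [m1 m2] := cell_mesh jp.
  by apply: osc => //; [exact: corner_square|exact: lt_trans m1 Nr|exact: lt_trans m2 Nr].
(* A cell mass involves four heights, each with error at most h. *)
have A4 : `|\sum_(j : 'I_N.+2 * 'I_N.+2) f (corner R j) * cell_mass G j - \sum_(j :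
  'I_N.+2 * 'I_N.+2) f (corner R j) * cell_mass F j| <=
    4%:R * h * \sum_(j : 'I_N.+2 * 'I_N.+2) `|f (corner R j)|.
  rewrite -sumrB mulr_sumr; apply: le_trans (ler_norm_sum _ _ _) _.
  apply: ler_sum => j _; rewrite -mulrBr normrM mulrC ler_wpM2r//.
  have hle (k l : nat) : (k < N.+3)%N -> (l < N.+3)%N ->
      `|G (node R N k) (node R N l) - F (node R N k) (node R N l)| <= h.
    by move=> kN lN; exact: (hh (Ordinal kN) (Ordinal lN)).
  have j1 : (j.1 < N.+2)%N by []. have j2 : (j.2 < N.+2)%N by [].
  have := hle j.1.+1 j.2.+1 j1 j2.
  have := hle j.1 j.2 (ltnW j1) (ltnW j2).
  have := hle j.1 j.2.+1 (ltnW j1) j2.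
  have := hle j.1.+1 j.2 j1 (ltnW j2).
  rewrite /cell_mass !ler_norml.
  by move=> /andP[? ?] /andP[? ?] /andP[? ?] /andP[? ?]; lra.
exact: dist_chain A1 A3 A4 A2.
Qed.

End comparison.

Theorem theorem1p5 (R : realType) (alpha beta : R)
  (alpha_gt0 : 0 < alpha) (beta01 : 0 <= beta <= 1)
  (c : forall n : nat, seq 'I_n.-1)
  (coxeter_c : forall n : nat, (1 <= n)%N -> coxeter_word (c n))
  (theta_cvg : forall z : R, 0 <= z <= 1 ->
     theta (coxeter_path (c n)) z @[n --> \oo] --> beta * z) :
  cvg_weakly_in_probability
    (fun (n : nat) (v : 'S_n) =>
       pi_perm (iter (Num.truncn (alpha * n%:R)) (tau_word (c n)) v))
    (nu alpha_gt0 beta01).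
Proof.
move=> f f_cont e e0.
have mf := measurable_on_square f_cont.
have [K fK] := bounded_square f_cont.
have e10 : 0 < e / 6%:R by lra.
have [r r0 osc] := unif_cont_square f_cont e10.
pose N := Num.truncn r^-1.
have rV0 : 0 < r^-1 by rewrite invr_gt0.
have Nr : N.+1%:R^-1 < r.
  rewrite invf_plt ?posrE//.
  by have /andP[] := truncn_itv (ltW rV0).
pose S := \sum_(j : 'I_N.+2 * 'I_N.+2) `|f (corner R j)|.
have S0 : 0 <= S by apply: sumr_ge0 => j _.
(* Makes 4 h S smaller than e / 2; the other half of e is three times e / 6. Adding 1 to S keeps the
   denominator positive when f vanishes at all corners. *)
pose h := e / (8%:R * (S + 1)).
have h0 : 0 < h by rewrite divr_gt0// mulr_gt0//; lra.
have hS : 4%:R * h * S < e / 2%:R.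
  have : h * (8%:R * (S + 1)) = e by rewrite divfK// gt_eqF// mulr_gt0//; lra.
  nra.
pose u n (v : 'S_n) := iter (Num.truncn (alpha * n%:R)) (tau_word (c n)) v.
pose bad (k l : 'I_N.+3) n := [set v : 'S_n | (h <= `|
  (height (grid_index n (node R N l)) (u n v) (grid_index n (node R N k)))%:R / n%:R
    - clipped_height alpha beta (node R N k) (node R N l)|)%R]%SET.
have bad_cvg k l : uniform_pr (bad k l n) @[n --> \oo] --> (0 : R).
  have clip01 (x : R) : 0 <= x -> 0 <= Num.min x 1 <= 1.
    by move=> x0; rewrite le_min x0 ler01 ge_min lexx orbT.
  apply: (@height_in_probability R alpha beta c) => //.
  - exact/clip01/node_ge0.
  - exact/clip01/node_ge0.
  - by move=> n; split; [exact: grid_index_le|exact/grid_index_near/node_ge0].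
  - by move=> n; split; [exact: grid_index_le|exact/grid_index_near/node_ge0].
(* The grid depends on f and e but not on n, so the sum has a fixed finite number of terms. *)
have bads_cvg : \sum_(kl : 'I_N.+3 * 'I_N.+3) uniform_pr (bad kl.1 kl.2 n)
    @[n --> \oo] --> (0 : R).
  elim: (index_enum _) => [|kl s IH].
    by under eq_fun do rewrite big_nil; exact: cvg_cst.
  under eq_fun do rewrite big_cons.
  by have := cvgD (bad_cvg kl.1 kl.2) IH; rewrite addr0; exact.
apply: (squeeze_cvgr _ (cvg_cst _) bads_cvg).
near=> n; rewrite uniform_pr_ge0 /=.
apply: le_trans (uniform_pr_bigcup _ _).
apply: uniform_pr_le; apply/fintype.subsetP => v; rewrite inE => ev.
apply: contraTT ev => vbad; rewrite -ltNge.
have n0 : (0 < n)%N by near: n; exact: nbhs_infty_gt.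
have nr : n%:R^-1 < r.
  rewrite invf_plt ?posrE ?ltr0n//.
  by near: n; exact: nbhs_infty_gtr.
have hh (k l : 'I_N.+3) :
    `|(height (grid_index n (node R N l)) (u n v) (grid_index n (node R N k)))%:R / n%:R
      - clipped_height alpha beta (node R N k) (node R N l)| <= h.
  apply/ltW; rewrite ltNge; apply: contraNN vbad => vb.
  by apply/finset.bigcupP; exists (k, l) => //; rewrite inE.
have := perm_integral_close alpha_gt0 beta01 n0 mf fK e10 nr Nr osc hh.
move=> /le_lt_trans; apply; rewrite -/S; lra.
Unshelve. all: by end_near.
Qed.
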